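(* Let $n$ and $\ell$ be integers with $-1\le\ell\le n-3$, let $t\in\{1,\ldots,n-1\}$, and let $d$ be an integer with $0\le d\le\lfloor\frac{n+\ell-1}{2}\rfloor$. Let $P$ be one of the following properties, with the corresponding value of $\ell$: Hamiltonicity ($\ell=0$); traceability ($\ell=-1$); Hamiltonian-connectedness ($\ell=1$); $k$-edge Hamiltonicity for some integer $1\le k\le n-3$ ($\ell=k$); $k$-Hamiltonicity for some integer $1\le k\le n-3$ ($\ell=k$). Put $i_d=\max\{1,d-\ell\}$ and $i_0=\lfloor\frac{n-1-\ell}{2}\rfloor$. Call an $n$-vertex graph $G$ extremal if $\delta(G)\ge d$, $G$ does not have $P$, and $s_t(G)=\max\{s_t(G_n^{\ell}(i_d)),s_t(G_n^{\ell}(i_0))\}$ (this value being an upper bound for $s_t$ over all $n$-vertex graphs with minimum degree at least $d$ not having $P$). Then, up to isomorphism: 1. If $s_t(G_n^{\ell}(i_d))<s_t(G_n^{\ell}(i_0))$, then for $t\le n-i_0-1$ the graph $G_n^{\ell}(i_0)$ is the unique extremal graph, and for $t>n-i_0-1$ the set of all extremal graphs is precisely $\mathcal{G}_n^{\ell}(i_0)$. 2. If $s_t(G_n^{\ell}(i_d))>s_t(G_n^{\ell}(i_0))$, then for $t\le n-i_d-1$ the graph $G_n^{\ell}(i_d)$ is the unique extremal graph, and for $t>n-i_d-1$ the set of all extremal graphs is precisely $\mathcal{G}_n^{\ell}(i_d)$. 3. If $s_t(G_n^{\ell}(i_d))=s_t(G_n^{\ell}(i_0))$, then for $t\le n-i_0-1$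 the set of extremal graphs is $\{G_n^{\ell}(i_d),G_n^{\ell}(i_0)\}$; for $n-i_0-1<t\le n-i_d-1$ it is $\mathcal{G}_n^{\ell}(i_0)\cup\{G_n^{\ell}(i_d)\}$; and for $t>n-i_d-1$ it is $\mathcal{G}_n^{\ell}(i_d)\cup\mathcal{G}_n^{\ell}(i_0)$.
   Context: All graphs are finite and simple. $K_m$ is the complete graph and $I_m$ the edgeless graph on $m$ vertices; $\cup$ denotes disjoint union (of graphs), and $A+B$ denotes the join (disjoint union of $A$ and $B$ together with all edges between them). For integers $n,i,\ell$ with $-1\le\ell\le n-3$ and $1\le i\le\frac{n-1-\ell}{2}$, define $G_n^{\ell}(i)=K_{i+\ell}+(I_i\cup K_{n-2i-\ell})$; when $i+\ell=0$ this is $I_1\cup K_{n-1}$. Let $\mathcal{G}_n^{\ell}(i)$ be the set of all spanning subgraphs of $G_n^{\ell}(i)$ in which the only edges allowed to be missing are edges of the $K_{n-2i-\ell}$. For $t\ge 1$, $s_t(G)$ is the number of $t$-stars (copies of $K_{1,t}$) in $G$: $s_t(G)=\sum_{v\in V(G)}\binom{d(v)}{t}$ for $t\ge 2$, and $s_1(G)=e(G)=\frac12\sum_{v}d(v)$. A graph is Hamiltonian if it has a Hamilton cycle (spanning cycle), traceable if it has a Hamilton path (spanning path), Hamiltonian-connected if it has a Hamilton path between every pair of distinct vertices. For $k\in\{0,\ldots,n-3\}$, an $n$-vertex graph $G$ is $k$-edge Hamiltonian if every linear forest in $G$ (disjoint union of paths) with at most $k$ edges is contained in a Hamilton cycle of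 $G$; it is $k$-Hamiltonian if the removal of any set of at most $k$ vertices results in a Hamiltonian graph. *)

(* Defs.v *)
From mathcomp Require Import all_boot all_order all_algebra.

Set Implicit Arguments.
Unset Strict Implicit.
Unset Printing Implicit Defensive.

Import Order.TTheory GRing.Theory Num.Theory.

Record graph (T : finType) := Graph {
  adj : rel T;
  adj_sym : symmetric adj;
  adj_irr : irreflexive adj }.

Definition isomorphic (T U : finType) (G : graph T) (H : graph U) : Prop :=
  exists f : T -> U, bijective f /\ (forall x y, adj H (f x) (f y) = adj G x y).

Definition subgraph (T : finType) (H G : graph T) : Prop :=
  subrel (adj H) (adj G).

Lemma complete_sym m : symmetric [rel x y : 'I_m | x != y].
Proof. by move=> x y /=; rewrite eq_sym. Qed.

Lemma complete_irr m : irreflexive [rel x y : 'I_m | x != y].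
Proof. by move=> x /=; rewrite eqxx. Qed.

Definition complete m : graph 'I_m := Graph (@complete_sym m) (@complete_irr m).

Definition edgeless m : graph 'I_m :=
  @Graph _ [rel x y | false] (fun _ _ => erefl) (fun _ => erefl).

Section Operations.
Variables (T U : finType) (G : graph T) (H : graph U).

(* [cross] tells whether the two sides are completely joined. *)
Definition sum_adj (cross : bool) : rel (T + U) := fun u v =>
  match u, v with
  | inl x, inl y => adj G x y
  | inr x, inr y => adj H x y
  | _, _ => cross
  end.

Lemma sum_adj_sym cross : symmetric (sum_adj cross).
Proof. by case=> x [] y //=; apply: adj_sym. Qed.

Lemma sum_adj_irr cross : irreflexive (sum_adj cross).
Proof. by case=> x /=; apply: adj_irr. Qed.

Definition disjoint_union : graph (T + U)%type :=
  Graph (sum_adj_sym false) (sum_adj_irr false).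

Definition join : graph (T + U)%type :=
  Graph (sum_adj_sym true) (sum_adj_irr true).

End Operations.

Section Induced.
Variables (T : finType) (G : graph T) (A : {set T}).

Definition induced_adj : rel {x : T | x \in A} :=
  fun u v => adj G (val u) (val v).

Lemma induced_adj_sym : symmetric induced_adj.
Proof. by move=> u v; apply: adj_sym. Qed.

Lemma induced_adj_irr : irreflexive induced_adj.
Proof. by move=> u; apply: adj_irr. Qed.

Definition induced : graph {x : T | x \in A} :=
  Graph induced_adj_sym induced_adj_irr.

End Induced.

Section Counting.
Variables (T : finType) (G : graph T).

Definition neighbours (x : T) : {set T} := [set y | adj G x y].

Definition degree (x : T) : nat := #|neighbours x|.

(* Degrees are at most [#|T|], so the default value is harmless on a
   nonempty vertex set. *)
Definition min_degree : nat := \big[minn/#|T|]_(x : T) degree x.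

Definition edges : {set {set T}} :=
  [set [set p.1; p.2] | p : T * T & adj G p.1 p.2].

Definition star (c : T) (L : {set T}) : {set {set T}} :=
  [set [set c; v] | v in L].

(* A copy of K_{1,t} is recorded by its edge set; hence for t = 1 each edge is
   counted once, although either of its ends can serve as the centre. *)
Definition stars (t : nat) : {set {set {set T}}} :=
  [set S | [exists c : T, exists L : {set T},
     [&& L \subset neighbours c, #|L| == t & S == star c L]]].

Definition num_stars (t : nat) : nat := #|stars t|.

Lemma leq_min_degree (d : nat) : 0 < #|T| ->
  d <= min_degree <-> forall x, d <= degree x.
Proof.
case/card_gt0P=> x0 _; rewrite /min_degree; split=> [le_d x | le_d].
  apply: leq_trans le_d _; elim: (index_enum T) (mem_index_enum x) => //= y r IHr.
  rewrite inE big_cons geq_min => /orP[/eqP->|/IHr->]; first by rewrite leqnn.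
  by rewrite orbT.
elim/big_ind: _ => [|a b da db|x _]; last exact: le_d.
  by apply: leq_trans (le_d x0) (max_card _).
by rewrite leq_min da.
Qed.

Lemma star_inj (c : T) (L M : {set T}) :
  c \notin L -> c \notin M -> star c L = star c M -> L = M.
Proof.
have sub (A B : {set T}) : c \notin A -> star c A = star c B -> A \subset B.
  move=> cA eqAB; apply/subsetP=> v vA.
  have : [set c; v] \in star c B by rewrite -eqAB; apply: imset_f.
  case/imsetP=> w wB /setP/(_ v); rewrite !inE eqxx orbT.
  case/esym/orP=> /eqP e; last by rewrite e.
  by rewrite -e vA in cA.
by move=> cL cM e; apply/eqP; rewrite eqEsubset !sub.
Qed.

Lemma starsE t : stars t =
  \bigcup_(c : T) [set star c L | L in [set L : {set T} |
                     (L \subset neighbours c) && (#|L| == t)]].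
Proof.
apply/setP=> S; rewrite inE; apply/existsP/bigcupP.
  case=> c /existsP[L /and3P[sub sz /eqP->]]; exists c => //.
  by apply: imset_f; rewrite inE sub.
case=> c _ /imsetP[L]; rewrite inE => /andP[sub sz] ->.
by exists c; apply/existsP; exists L; rewrite sub sz eqxx.
Qed.

Lemma star_centre (c c' : T) (L M : {set T}) :
  1 < #|L| -> c \notin L -> star c L = star c' M -> c = c'.
Proof.
case/card_gt1P=> u [v [uL vL neq_uv]] cL eqS.
have inS w : w \in L -> c' = c \/ c' = w.
  move=> wL; have : [set c; w] \in star c' M by rewrite -eqS; apply: imset_f.
  case/imsetP=> z _ /setP/(_ c'); rewrite !inE eqxx /=.
  by case/orP=> /eqP ->; [left | right].
case: (inS u uL) => [-> //|cu]; case: (inS v vL) => [-> //|cv].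
by rewrite -cu -cv eqxx in neq_uv.
Qed.

Lemma num_starsE t : 1 < t -> num_stars t = \sum_(x : T) 'C(degree x, t).
Proof.
move=> t_gt1; rewrite /num_stars starsE.
pose B c := [set star c L | L in [set L : {set T} |
               (L \subset neighbours c) && (#|L| == t)]].
have cardB c : #|B c| = 'C(degree c, t).
  rewrite card_in_imset; first exact: cards_draws.
  move=> L M; rewrite !inE => /andP[/subsetP sL _] /andP[/subsetP sM _].
  apply: star_inj; first by apply/negP=> /sL; rewrite inE adj_irr.
  by apply/negP=> /sM; rewrite inE adj_irr.
have triv c c' S : S \in B c -> S \in B c' -> c = c'.
  case/imsetP=> L; rewrite inE => /andP[/subsetP sL /eqP cL] ->.
  case/imsetP=> M _; apply: star_centre; first by rewrite cL.
  by apply/negP=> /sL; rewrite inE adj_irr.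
rewrite -sum1_card partition_disjoint_bigcup /=.
  by apply: eq_bigr => c _; rewrite sum1_card cardB.
move=> c c' neq; apply/pred0P=> S /=; apply/negP=> /andP[Sc Sc'].
by rewrite (triv _ _ _ Sc Sc') eqxx in neq.
Qed.

Lemma num_stars1 : num_stars 1 = #|edges|.
Proof.
rewrite /num_stars -(card_imset [in edges] (@set1_inj {set T})).
apply: eq_card => S; rewrite inE; apply/existsP/imsetP.
  case=> c /existsP[L /and3P[/subsetP sL /cards1P[v eL] /eqP->]].
  exists [set c; v]; last by rewrite eL /star imset_set1.
  have cv : v \in neighbours c by apply: sL; rewrite eL set11.
  by rewrite inE in cv; apply/imsetP; exists (c, v); rewrite // inE.
case=> _ /imsetP[[c v] cv ->] ->; exists c; apply/existsP; exists [set v].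
rewrite inE /= in cv; rewrite sub1set cards1 /star imset_set1 !eqxx !andbT.
by rewrite inE.
Qed.

End Counting.

Section Hamiltonian.
Variables (T : finType) (G : graph T).

Definition hamilton_path (p : seq T) : Prop :=
  [/\ sorted (adj G) p, uniq p & forall x, x \in p].

Definition hamilton_cycle (c : seq T) : Prop :=
  [/\ 2 < size c, cycle (adj G) c, uniq c & forall x, x \in c].

Definition hamiltonian : Prop := exists c, hamilton_cycle c.

Definition traceable : Prop := exists p, hamilton_path p.

Definition hamiltonian_connected : Prop :=
  forall x y, x != y -> exists2 p, hamilton_path (x :: p) & last x p = y.

Definition consecutive (p : seq T) (x y : T) : bool :=
  infix [:: x; y] p || infix [:: y; x] p.

(* The list [ps] gives the vertex sequences of the component paths; isolated
   vertices may be listed or omitted. *)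
Definition linear_forest (F : graph T) : Prop :=
  exists ps : seq (seq T), uniq (flatten ps) /\
    (forall x y, adj F x y = has (fun p => consecutive p x y) ps).

Definition cycle_contains (c : seq T) (F : graph T) : Prop :=
  forall x y, adj F x y -> (y == next c x) || (x == next c y).

Definition edge_hamiltonian (k : nat) : Prop :=
  forall F : graph T, subgraph F G -> linear_forest F -> #|edges F| <= k ->
  exists2 c, hamilton_cycle c & cycle_contains c F.

End Hamiltonian.

Definition vertex_hamiltonian (T : finType) (G : graph T) (k : nat) : Prop :=
  forall S : {set T}, #|S| <= k -> hamiltonian (induced G (~: S)).

Inductive property :=
  | Hamiltonicity
  | Traceability
  | HamiltonianConnectedness
  | EdgeHamiltonicity of nat
  | VertexHamiltonicity of nat.

Definition satisfies (P : property) (T : finType) (G : graph T) : Prop :=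
  match P with
  | Hamiltonicity => hamiltonian G
  | Traceability => traceable G
  | HamiltonianConnectedness => hamiltonian_connected G
  | EdgeHamiltonicity k => edge_hamiltonian G k
  | VertexHamiltonicity k => vertex_hamiltonian G k
  end.

Definition ell (P : property) : int :=
  match P with
  | Hamiltonicity => 0
  | Traceability => -1
  | HamiltonianConnectedness => 1
  | EdgeHamiltonicity k | VertexHamiltonicity k => k%:Z
  end%R.

Definition admissible (n : nat) (P : property) : Prop :=
  match P with
  | EdgeHamiltonicity k | VertexHamiltonicity k => 1 <= k <= n - 3
  | _ => True
  end.

Local Open Scope ring_scope.

(* The absolute values only cast to [nat]: the three sizes are nonnegative when
   -1 <= l <= n - 3 and 1 <= i <= (n - 1 - l) / 2. *)
Definition Gvertex (n : nat) (l i : int) : finType :=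
  ('I_(absz (i + l)%R) + ('I_(absz i) + 'I_(absz (n%:Z - 2 * i - l)%R)))%type.

Definition Gnl (n : nat) (l i : int) : graph (Gvertex n l i) :=
  join (complete (absz (i + l)%R))
       (disjoint_union (edgeless (absz i))
                       (complete (absz (n%:Z - 2 * i - l)%R))).

Definition in_last_clique (n : nat) (l i : int) (x : Gvertex n l i) : bool :=
  if x is inr (inr _) then true else false.

Definition Gfamily (n : nat) (l i : int) (H : graph (Gvertex n l i)) : Prop :=
  subgraph H (Gnl n l i) /\
  (forall x y, adj (Gnl n l i) x y -> ~~ adj H x y ->
     in_last_clique x /\ in_last_clique y).

Definition in_Gfamily (n : nat) (l i : int) (T : finType) (G : graph T) : Prop :=
  exists2 H : graph (Gvertex n l i), Gfamily H & isomorphic G H.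

Definition idx_d (l : int) (d : nat) : int := Num.max 1 (d%:Z - l).

Definition idx_0 (n : nat) (l : int) : int := ((n%:Z - 1 - l) %/ 2)%Z.

Definition star_bound (n : nat) (l : int) (t d : nat) : nat :=
  maxn (num_stars (Gnl n l (idx_d l d)) t) (num_stars (Gnl n l (idx_0 n l)) t).

Definition candidate (n d : nat) (P : property) (T : finType) (G : graph T) :
    Prop :=
  [/\ #|T| = n, (d <= min_degree G)%N & ~ satisfies P G].

Definition extremal (n : nat) (l : int) (t d : nat) (P : property)
    (T : finType) (G : graph T) : Prop :=
  candidate n d P G /\ num_stars G t = star_bound n l t d.

(* Main.v *)
Require Import Defs.
From mathcomp Require Import all_boot all_order all_algebra.
From mathcomp Require Import zify.

Set Implicit Arguments.
Unset Strict Implicit.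
Unset Printing Implicit Defensive.

Import Order.TTheory GRing.Theory Num.Theory.

(* All five properties reduce to Hamilton cycles containing a prescribed set of
   edges: Hamiltonian-connectedness asks for a cycle of [G + xy] through [xy],
   traceability for a Hamilton cycle of [G] joined with one new vertex.  The
   crossing argument of Ore then shows that [P] is inherited by [G] from [G + uv]
   when [d(u) + d(v) >= n + l], and Chvatal's argument, applied to the closure,
   yields for every [G] without [P] an index [i] such that [i] vertices have
   degree at most [i + l] and [n - i - l] have degree at most [n - i - 1].
   Summing binomials of degrees bounds the number of stars of [G] by that of
   [Gnl n l i], and the equality case determines the edges of [G], up to those
   inside the last clique when its vertices are centres of no [t]-star.  The
   bound is a convex function of [i], strictly below its larger neighbour at
   every interior index, so only the two ends of the range of [i] matter. *)

(** * Adding an edge, and Hamilton cycles through prescribed edges *)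

Lemma adj_neq (T : finType) (G : graph T) x y : adj G x y -> x != y.
Proof. by apply: contraTneq => ->; rewrite adj_irr. Qed.

Section EdgeOperations.
Variable T : finType.
Implicit Types (G F : graph T) (u v x y : T).

Definition empty_graph : graph T :=
  @Graph T [rel x y | false] (fun _ _ => erefl) (fun _ => erefl).

(** The conjunct [u != v] gives irreflexivity for all arguments, so [add_edge G u v] is a graph
    without any side condition. *)
Definition edge_rel u v : rel T := fun x y =>
  (u != v) && ((x == u) && (y == v) || (x == v) && (y == u)).

Lemma edge_rel_sym u v : symmetric (edge_rel u v).
Proof. by move=> x y; rewrite /edge_rel orbC ![(y == _) && _]andbC. Qed.

Lemma edge_rel_irr u v : irreflexive (edge_rel u v).
Proof.
move=> x; apply/negP=> /andP[/eqP uv] /orP[] /andP[/eqP e1 /eqP e2];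
  by apply: uv; rewrite -e1 -e2.
Qed.

Definition edge_graph u v : graph T :=
  Graph (@edge_rel_sym u v) (@edge_rel_irr u v).

Lemma add_edge_sym G u v : symmetric [rel x y | adj G x y || edge_rel u v x y].
Proof. by move=> x y /=; rewrite adj_sym edge_rel_sym. Qed.

Lemma add_edge_irr G u v :
  irreflexive [rel x y | adj G x y || edge_rel u v x y].
Proof. by move=> x /=; rewrite adj_irr edge_rel_irr. Qed.

Definition add_edge G u v : graph T :=
  Graph (@add_edge_sym G u v) (@add_edge_irr G u v).

Lemma edge_relC u v : edge_rel u v =2 edge_rel v u.
Proof. by move=> x y; rewrite /edge_rel eq_sym orbC. Qed.

Lemma edge_relxx u v : u != v -> edge_rel u v u v.
Proof. by rewrite /edge_rel => ->; rewrite !eqxx. Qed.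

Lemma edge_rel_imp u v x y : edge_rel u v x y ->
  (x = u /\ y = v) \/ (x = v /\ y = u).
Proof.
by case/andP=> _ /orP[] /andP[/eqP-> /eqP->]; [left|right].
Qed.

(** This is the relation inside [cycle_contains], named because it survives rotation and reversal of
    the cycle. *)
Definition cyc_adj (c : seq T) x y := (y == next c x) || (x == next c y).

Lemma cyc_adjC c x y : cyc_adj c x y = cyc_adj c y x.
Proof. exact: orbC. Qed.

Definition ham_cycle_through G F :=
  exists2 c, hamilton_cycle G c & cycle_contains c F.

Lemma sub_hamilton_cycle G H c :
  subrel (adj G) (adj H) -> hamilton_cycle G c -> hamilton_cycle H c.
Proof. by move=> sub [? cy ? ?]; split=> //; apply: sub_cycle cy. Qed.

Lemma eq_ham_cycle_through G H F : adj G =2 adj H ->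
  ham_cycle_through G F -> ham_cycle_through H F.
Proof.
by move=> eqGH [c hc cF]; exists c => //; apply: sub_hamilton_cycle hc => x y;
  rewrite eqGH.
Qed.

Lemma next_index (x0 : T) c i : uniq c -> i < size c ->
  next c (nth x0 c i) = nth x0 c (if i.+1 < size c then i.+1 else 0).
Proof.
move=> uc ic; rewrite next_nth mem_nth //.
case: c uc ic => // y c uc ic; rewrite index_uniq //.
rewrite [size _]/= ltnS; case: ifP => [lt|/negbT].
  by rewrite /=; apply: set_nth_default.
(* The default value of [nth] in [next_nth] is the head of the cycle; reading past the end is the
   wrap-around to position 0. *)
by rewrite -leqNgt => le; rewrite nth_default.
Qed.

Lemma cyc_adj_nth (x0 : T) c i : uniq c -> i.+1 < size c ->
  cyc_adj c (nth x0 c i) (nth x0 c i.+1).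
Proof. by move=> uc ic; rewrite /cyc_adj next_index ?ic ?eqxx // ltnW. Qed.

Lemma eq_next_cyc_adj c c' : next c =1 next c' -> cyc_adj c =2 cyc_adj c'.
Proof. by move=> e x y; rewrite /cyc_adj !e. Qed.

Lemma rev_cyc_adj c : uniq c -> cyc_adj (rev c) =2 cyc_adj c.
Proof.
move=> uc x y; rewrite /cyc_adj !next_rev //.
have e a b : (a == prev c b) = (b == next c a).
  by rewrite -(can2_eq (prev_next uc) (next_prev uc)) eq_sym.
by rewrite !e orbC.
Qed.

Lemma rev_hamilton_cycle G c : hamilton_cycle G c -> hamilton_cycle G (rev c).
Proof.
case=> sc cy uc full; split; rewrite ?size_rev ?rev_uniq //.
  by rewrite rev_cycle; apply: sub_cycle cy => x y; rewrite adj_sym.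
by move=> x; rewrite mem_rev.
Qed.

(** Rotate the cycle so that uv is its closing step; no other step can be uv, so the rest is a path
    of [G]. Keeping [cyc_adj] unchanged lets the edges of a prescribed forest be followed. *)
Lemma open_hamilton_cycle G u v c : u != v ->
  hamilton_cycle (add_edge G u v) c -> cyc_adj c u v ->
  exists p, [/\ hamilton_path G (u :: p), last u p = v &
    cyc_adj (u :: p) =2 cyc_adj c].
Proof.
(* After a reversal, [u] is the successor of [v]. *)
move=> uv hc; wlog: c hc / u == next c v => [hw|].
  case/orP; last by move=> e; apply: hw; rewrite /cyc_adj ?e ?orbT.
  move=> e; have [_ _ uc _] := hc.
  have e' : u == next (rev c) v by rewrite next_rev // (eqP e) prev_next.
  have [|p [hp lp ep]] := hw _ (rev_hamilton_cycle hc) e'.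
    by rewrite /cyc_adj e' orbT.
  by exists p; split=> // x y; rewrite ep rev_cyc_adj.
move/eqP=> e _; have [sc cy uc full] := hc.
have [j p ep] := rot_to (full u).
have nx : next (u :: p) =1 next c by move=> x; rewrite -ep next_rot.
have up : uniq (u :: p) by rewrite -ep rot_uniq.
have sp : size (u :: p) = size c by rewrite -ep size_rot.
have fp x : x \in u :: p by rewrite -ep mem_rot.
have lp : last u p = v.
  have := next_index u up (ltnSn (size p)); rewrite [size (_ :: _)]/= ltnn.
  rewrite nth_last /= => e1.
  by apply: (can_inj (prev_next up)); rewrite [RHS]nx -e; exact: e1.
exists p; split=> //; last exact: eq_next_cyc_adj.
split=> //=; have := cy; rewrite -(rot_cycle j) ep [cycle _ _]/= rcons_path.
case/andP=> /(pathP u) pth _; apply/(pathP u) => i ip.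
have /orP[//|/edge_rel_imp] := pth i ip.
have nthp k : k <= size p -> forall m, m <= size p ->
    nth u (u :: p) k = nth u (u :: p) m -> k = m.
  by move=> kp m mp /eqP; rewrite nth_uniq // => /eqP.
rewrite -[nth u p i]/(nth u (u :: p) i.+1) -lp (last_nth u).
have p2 : 1 < size p by move: sc; rewrite -sp.
(* A step from [u] to [v] would start at position 0 and end at the last one, leaving a cycle of two
   vertices; a step from [v] to [u] would end at position 0. *)
case=> -[e1 e2].
  have e3 := nthp _ ip _ (leqnn _) e2; have := nthp _ (ltnW ip) 0 isT e1.
  by move=> i0; rewrite -e3 i0 in p2.
by have := nthp _ ip 0 isT e2.
Qed.

Lemma hamilton_cycleVedge G u v c : hamilton_cycle (add_edge G u v) c ->
  hamilton_cycle G c \/ (u != v) && cyc_adj c u v.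
Proof.
case=> sc cy uc full; case: (boolP ((u != v) && cyc_adj c u v)); first by right.
move=> nuv; left; split=> //; apply: cycle_from_next => // x xc.
have /orP[//|h] := next_cycle cy xc; case/negP: nuv; rewrite (andP h).1 /=.
by case: (edge_rel_imp h) => -[<- <-]; rewrite /cyc_adj eqxx ?orbT.
Qed.

(** Different positions of a duplicate-free sequence give different unordered pairs of consecutive
    vertices. *)
Lemma card_path_edges G (s : seq T) (x0 : T) k (D : {pred 'I_k}) :
  uniq s -> k < size s ->
  (forall j : 'I_k, j \in D -> adj G (nth x0 s j) (nth x0 s j.+1)) ->
  #|D| <= #|edges G|.
Proof.
move=> us ks adjD; pose f (j : 'I_k) := [set nth x0 s j; nth x0 s j.+1].
have ltj (j : 'I_k) : j < size s by apply: ltn_trans ks.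
have ltj1 (j : 'I_k) : j.+1 < size s by apply: leq_ltn_trans ks.
have f_inj : injective f.
  move=> i j; rewrite /f => /setP eqf.
  have := eqf (nth x0 s i); have := eqf (nth x0 s i.+1).
  rewrite !inE !eqxx orbT /= !nth_uniq //.
  by move=> /esym/orP h1 /esym/orP h2; apply: val_inj => /=; lia.
rewrite -(card_imset D f_inj) subset_leq_card //; apply/subsetP => e.
case/imsetP=> j jD ->; apply/imsetP; exists (nth x0 s j, nth x0 s j.+1) => //.
by rewrite inE /=; apply: adjD.
Qed.

End EdgeOperations.

(** * Ore's crossing argument with prescribed edges *)

Section Ore.
Variable T : finType.
Implicit Types (G F : graph T) (u v w x y : T).

Lemma degree_leq_surj G w (I : finType) (g : I -> T) :
  (forall x, adj G w x -> exists j, g j = x) ->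
  degree G w <= #|[set j | adj G w (g j)]|.
Proof.
move=> surj; apply: leq_trans (leq_imset_card g _); apply: subset_leq_card.
apply/subsetP=> x; rewrite inE => wx; have [j ej] := surj x wx.
by apply/imsetP; exists j; rewrite ?inE ej.
Qed.

(** If the cycle uses uv, cut it there into a path [s] from [u] to [v] with [N] steps. More than [k]
    steps [j] have both [u] adjacent to the later vertex and [v] adjacent to the earlier one, since
    the degrees add up to at least [N + 1 + k]. One such step is not in [F]; it is exchanged,
    together with uv, for the two crossing edges. *)
Lemma ham_cycle_through_add_edge G F u v k :
  u != v -> ~~ adj G u v -> subgraph F G -> #|edges F| <= k ->
  #|T| + k <= degree G u + degree G v ->
  ham_cycle_through (add_edge G u v) F -> ham_cycle_through G F.
Proof.
move=> uv nuv FG Fk deg [c hc cF].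
case: (hamilton_cycleVedge hc) => [hc'|]; first by exists c.
case/andP=> _ /(open_hamilton_cycle uv hc)[p [[pth us full] lp ep]].
rewrite /= in pth; set s := u :: p in us full ep; set N := size p.
have sN : size s = N.+1 by [].
have cardT : #|T| = N.+1.
  by rewrite -sN -(card_uniqP us); apply: eq_card => x; rewrite full.
have vN : nth u s N = v by rewrite -lp (last_nth u).
pose X := [set j : 'I_N | adj G u (nth u s j.+1)].
pose Y := [set j : 'I_N | adj G v (nth u s j)].
pose Z := [set j : 'I_N | adj F (nth u s j) (nth u s j.+1)].
have degX : degree G u <= #|X|.
  apply: degree_leq_surj => x ux; have := full x; rewrite inE.
  case/predU1P=> [xu|xp]; first by rewrite xu adj_irr in ux.
  have ip : index x p < N by rewrite index_mem.
  by exists (Ordinal ip); rewrite /= nth_index.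
have degY : degree G v <= #|Y|.
  apply: degree_leq_surj => x vx; have := full x; rewrite -index_mem sN ltnS.
  rewrite leq_eqVlt => /predU1P[ix|ix].
    by rewrite -(nth_index u (full x)) ix vN adj_irr in vx.
  by exists (Ordinal ix); rewrite /= nth_index.
have ltZ : #|Z| < #|X :&: Y|.
  have := cardsUI X Y; have := max_card (X :|: Y); rewrite card_ord.
  have : #|Z| <= k.
    apply: leq_trans Fk; apply: (@card_path_edges _ F s u) => // j.
    by rewrite inE.
  by move: deg degX degY; rewrite cardT; lia.
have [j] : exists j, j \in (X :&: Y) :\: Z.
  apply/set0Pn; rewrite setD_eq0; apply/negP => /subset_leq_card.
  by rewrite leqNgt ltZ.
rewrite !inE => /and3P[nF uj vj]; have jN := ltn_ord j.
(* The new cycle goes forwards from position [j + 1] to [v], jumps to position [j], goes backwards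
   to [u], and closes by the edge from [u] to position [j + 1]. *)
pose c' := drop j.+1 s ++ rev (take j.+1 s).
have pe : perm_eq c' s.
  by rewrite /c' -[X in perm_eq _ X](cat_take_drop j.+1 s) perm_catC
    perm_cat2r perm_rev.
have uc : uniq c' by rewrite (perm_uniq pe).
have sc' : size c' = N.+1 by rewrite (perm_size pe).
have size_take : size (take j.+1 s) = j.+1 by rewrite size_takel // sN; lia.
have nth_c' i : i <= N -> nth u c' i =
    if i < N - j then nth u s (j.+1 + i) else nth u s (N - i).
  move=> iN; rewrite /c' nth_cat size_drop sN subSS nth_drop.
  case: ltnP => // ij; rewrite nth_rev size_take; last lia.
  by rewrite nth_take; [congr (nth _ _ _); lia | lia].
have spath i : i < N -> adj G (nth u s i) (nth u s i.+1).
  by move=> iN; apply: (pathP u pth).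
exists c'.
  split; rewrite ?sc' //.
  - by have [sc _ uc0 _] := hc; rewrite -cardT; apply: leq_trans sc _;
      rewrite -(card_uniqP uc0) max_card.
  - apply: cycle_from_next => // x xc.
    rewrite -(nth_index u xc); move: xc; rewrite -index_mem.
    set i := index x c'; move=> ic; rewrite next_index // sc'.
    rewrite sc' in ic; case: ltnP => [lt|ge].
      rewrite !nth_c' //; case: (ltnP i (N - j)) => h1.
        case: (ltnP i.+1 (N - j)) => h2; first by rewrite addnS spath //; lia.
        have -> : j.+1 + i = N by lia.
        have -> : N - i.+1 = j by lia.
        by rewrite vN.
      rewrite ltnNge (leq_trans h1) //= adj_sym.
      have -> : N - i = (N - i.+1).+1 by lia.
      by apply: spath; lia.
    have -> : i = N by lia.
    rewrite !nth_c' // ltnNge leq_subr /= subnn addn0 subn_gt0 jN.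
    by rewrite [nth u s 0]/=.
  - by move=> x; rewrite (perm_mem pe).
(* Step [j] is the only step of the path that is lost: position [m <= j] of [s] moves to [N - m], a
   later one to [m - j.+1]. *)
have step i : i < N -> i != j -> cyc_adj c' (nth u s i) (nth u s i.+1).
  move=> iN ij; case: (ltnP i j) => h.
    have low m : m <= j -> nth u s m = nth u c' (N - m).
      move=> mj; rewrite nth_c' ?leq_subr // ltnNge leq_sub2l //= subKn //; lia.
    rewrite low ?(ltnW h) // low //.
    have -> : N - i = (N - i.+1).+1 by lia.
    by rewrite cyc_adjC; apply: cyc_adj_nth => //; rewrite sc'; lia.
  have high m : j < m <= N -> nth u s m = nth u c' (m - j.+1).
    move=> mj; rewrite nth_c'; last lia.
    have -> : m - j.+1 < N - j by lia.
    by rewrite subnKC //; lia.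
  rewrite high; last lia.
  rewrite high; last lia.
  have -> : i.+1 - j.+1 = (i - j.+1).+1 by lia.
  by apply: cyc_adj_nth => //; rewrite sc'; lia.
have nextF x y : adj F x y -> y = next s x -> cyc_adj c' x y.
  move=> Fxy ey; have xs := full x; move: Fxy; rewrite {}ey.
  rewrite -(nth_index u xs); move: xs; rewrite -index_mem.
  set i := index x s; rewrite sN => iN; rewrite next_index // sN.
  case: ltnP => h Fxy.
    apply: step => //; apply/eqP => e; case/negP: nF; by rewrite -e.
  (* The closing step of [s] joins [v] to [u]; it is not an edge of [G], hence not of [F]. *)
  have e : i = N by lia.
  by move: Fxy; rewrite e vN => /FG; rewrite adj_sym (negPf nuv).
move=> x y Fxy; have := cF x y Fxy; rewrite -[_ || _]/(cyc_adj c x y) -ep.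
case/orP=> /eqP e; first exact: nextF.
by rewrite -[_ || _]/(cyc_adj c' x y) cyc_adjC; apply: nextF; rewrite // adj_sym.
Qed.

End Ore.

(** * Joining with one new vertex, for traceability *)

Section Cone.
Variables (T : finType) (G : graph T).

Definition cone_adj : rel (option T) := fun x y =>
  match x, y with
  | Some x, Some y => adj G x y
  | None, None => false
  | _, _ => true
  end.

Lemma cone_adj_sym : symmetric cone_adj.
Proof. by case=> [x|] [y|] //=; apply: adj_sym. Qed.

Lemma cone_adj_irr : irreflexive cone_adj.
Proof. by case=> [x|] //=; apply: adj_irr. Qed.

Definition cone : graph (option T) := Graph cone_adj_sym cone_adj_irr.

(** The apex [None] closes a Hamilton path to a cycle, and deleting it opens a cycle to a path. The
    bound on [#|T|] supplies the three vertices that a cycle must have. *)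
Lemma traceable_cone : 1 < #|T| -> traceable G <-> hamiltonian cone.
Proof.
move=> T2; have pathS x p : path (adj cone) (Some x) (map Some p) = path (adj G) x p.
  by elim: p x => //= y p IHp x; rewrite IHp.
split=> [[p [sp up full]]|[c [sc cy uc full]]].
  have sizep : size p = #|T|.
    by rewrite -(card_uniqP up); apply: eq_card => x; rewrite full.
  exists (None :: map Some p); split.
  - by rewrite /= size_map sizep.
  - case: p sp sizep {up full} => [|x p] /= sp sizep; first by rewrite -sizep in T2.
    by rewrite rcons_path pathS sp; case: (lastP p) => // s z;
      rewrite map_rcons last_rcons.
  - rewrite cons_uniq (map_inj_uniq Some_inj) up andbT.
    by apply/negP=> /mapP[].
  - by case=> [x|]; rewrite ?inE // map_f.
have [j s es] := rot_to (full None).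
have us : uniq (None :: s) by rewrite -es rot_uniq.
have fs x : x \in None :: s by rewrite -es mem_rot.
(* By uniqueness [None] does not recur after the head, so [pmap id] drops nothing. *)
have es' : s = map Some (pmap id s).
  elim: s us {es fs} => //= -[x|] s IHs; rewrite ?inE //.
  by case/and3P=> n1 n2 u /=; rewrite -IHs //= n1.
exists (pmap id s); split.
- have : cycle (adj cone) (None :: s) by rewrite -es rot_cycle.
  move: es'; move: (pmap id s) => q ->; case: q => //= x p.
  by rewrite rcons_path pathS; case/andP.
- by rewrite -(map_inj_uniq Some_inj) -es'; case/andP: us.
- by move=> x; rewrite -(mem_map Some_inj) -es'; have := fs (Some x); rewrite inE.
Qed.

Lemma degree_cone x : degree cone (Some x) = (degree G x).+1.
Proof.
rewrite /degree (cardsD1 None) inE /= add1n; congr _.+1.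
rewrite -(card_imset _ Some_inj); apply: eq_card => -[y|]; rewrite !inE /=.
  by rewrite mem_imset ?inE //; apply: Some_inj.
by apply/esym/negP=> /imsetP[].
Qed.

End Cone.

(** * The properties as Hamilton cycles through prescribed edges *)

Section Reformulation.
Variable T : finType.
Implicit Types (G F : graph T) (u v x y : T).

Lemma hamiltonian_through G :
  hamiltonian G <-> ham_cycle_through G (empty_graph T).
Proof. by split=> [[c hc]|[c hc _]]; exists c. Qed.

Lemma eq_hamiltonian G H : adj G =2 adj H -> hamiltonian G -> hamiltonian H.
Proof.
by move=> e /hamiltonian_through h; apply/hamiltonian_through;
  apply: eq_ham_cycle_through h.
Qed.

(** A Hamilton path from [x] to [y] is a Hamilton cycle through xy cut at xy; this edge has to be
    added because it may be absent from [G]. *)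
Lemma hamiltonian_connected_through G : 2 < #|T| ->
  hamiltonian_connected G <-> forall x y, x != y ->
    ham_cycle_through (add_edge G x y) (edge_graph x y).
Proof.
move=> T3; split=> h x y xy.
  have [p [sp up full] lp] := h x y xy; exists (x :: p).
    split=> //.
      by rewrite -(card_uniqP up); apply: leq_trans T3 _; rewrite subset_leq_card //;
        apply/subsetP=> z; rewrite full.
    rewrite /= rcons_path lp /= edge_rel_sym edge_relxx // orbT andbT.
    by apply: sub_path sp => a b /= ->.
  have cxy : cyc_adj (x :: p) x y.
    rewrite /cyc_adj; apply/orP; right.
    have := next_index x up (ltnSn (size p)).
    by rewrite [size _]/= ltnn nth_last -[last _ _]/(last x p) lp => ->.
  by move=> a b /edge_rel_imp[] [-> ->] //; rewrite -[_ || _]/(cyc_adj _ _ _) cyc_adjC.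
have [c hc cF] := h x y xy.
have cxy : cyc_adj c x y by apply: cF; apply: edge_relxx.
by have [p [hp lp _]] := open_hamilton_cycle xy hc cxy; exists p.
Qed.

Lemma linear_forest_empty : linear_forest (empty_graph T).
Proof. by exists [::]. Qed.

Lemma linear_forest_edge x y : x != y -> linear_forest (edge_graph x y).
Proof.
move=> xy; exists [:: [:: x; y]]; rewrite /= inE xy; split=> // a b.
rewrite orbF /consecutive /edge_rel xy /=.
by rewrite !(andbT, andbF, orbF); congr (_ || _); rewrite andbC.
Qed.

Lemma infix2_next x y c : uniq c -> infix [:: x; y] c -> y = next c x.
Proof.
move=> uc /infixP[s1 [s2 ec]]; subst c.
have lt2 : (size s1).+1 < size (s1 ++ [:: x; y] ++ s2) by rewrite !size_cat /=; lia.
have := next_index x uc (ltnW lt2); rewrite lt2 !nth_cat ltnn subnn.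
have -> : ((size s1).+1 < size s1) = false by rewrite ltnNge leqnSn.
by rewrite subSnn /= => ->.
Qed.

Lemma complete_ham_cycle_through G F : (forall x y, x != y -> adj G x y) ->
  2 < #|T| -> linear_forest F -> ham_cycle_through G F.
Proof.
move=> cG T3 [ps [ups eF]].
(* The component paths one after the other, followed by the vertices on none of them. *)
pose c := flatten ps ++ filter [predC flatten ps] (enum T).
have uc : uniq c.
  rewrite cat_uniq ups filter_uniq ?enum_uniq // andbT /=.
  by apply/hasPn=> x; rewrite mem_filter => /andP[].
have full x : x \in c.
  by rewrite mem_cat mem_filter /= mem_enum andbT orbN.
have sc : 2 < size c.
  by rewrite -(card_uniqP uc); apply: leq_trans T3 _; rewrite subset_leq_card //;
    apply/subsetP=> z; rewrite full.
exists c.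
  split=> //; apply: cycle_from_next => // x xc; apply: cG; apply/eqP.
  rewrite -(nth_index x xc); move: xc; rewrite -index_mem.
  move: (index x c) => i ic; rewrite next_index //.
  case: ltnP => h /eqP; rewrite nth_uniq //.
  - by move/eqP; lia.
  - by move/eqP => i0; rewrite i0 in h; move: sc; rewrite ltnNge (leq_trans h).
  - exact: ltn_trans sc.
have inf x y p : p \in ps -> infix [:: x; y] p -> y = next c x.
  move=> pps h; apply: infix2_next => //; apply: infix_trans h _.
  have [s1 [s2 eps]] : exists s1 s2, ps = s1 ++ p :: s2.
    by case/splitPr: pps => s1 s2; exists s1, s2.
  by rewrite /c eps flatten_cat /= -!catA infix_infix.
move=> x y; rewrite eF => /hasP[p pps /orP[] /(inf _ _ _ pps) ->];
  by rewrite eqxx ?orbT.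
Qed.

Lemma degree_sub G H x : subgraph G H -> degree G x <= degree H x.
Proof.
by move=> sub; apply: subset_leq_card; apply/subsetP=> y; rewrite !inE => /sub.
Qed.

Lemma sub_add_edge G u v : subgraph G (add_edge G u v).
Proof. by move=> x y /= ->. Qed.

Lemma edges_empty : #|edges (empty_graph T)| = 0.
Proof.
apply/eqP; rewrite cards_eq0 -subset0.
by apply/subsetP => e /imsetP[p]; rewrite inE.
Qed.

Lemma edges_edge_graph x y : #|edges (edge_graph x y)| <= 1.
Proof.
rewrite -(cards1 [set x; y]) subset_leq_card //; apply/subsetP => e.
case/imsetP=> -[a b]; rewrite inE /= => /edge_rel_imp h ->.
by case: h => -[-> ->]; rewrite inE // setUC.
Qed.

Lemma hamiltonian_add_edge G u v : u != v -> ~~ adj G u v ->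
  #|T| <= degree G u + degree G v -> hamiltonian (add_edge G u v) ->
  hamiltonian G.
Proof.
move=> uv nuv deg /hamiltonian_through h; apply/hamiltonian_through.
by apply: (@ham_cycle_through_add_edge _ _ _ u v 0) h => //;
  rewrite ?edges_empty ?addn0.
Qed.

End Reformulation.

(** * Degrees after the deletion of vertices *)

Section Deletion.
Variables (T : finType) (G : graph T) (A : {set T}).

Lemma card_val_preim (B : {set T}) :
  #|[set x : {x : T | x \in A} | val x \in B]| = #|B :&: A|.
Proof.
rewrite -(card_imset _ val_inj); apply: eq_card => y; rewrite inE.
apply/imsetP/andP=> [[x]|[yB yA]].
  by rewrite inE => xB ->; split=> //; apply: (valP x).
by exists (Sub y yA); rewrite ?inE SubK.
Qed.

Lemma card_sig_set : #|{: {x : T | x \in A}}| = #|A|.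
Proof. by rewrite card_sig; apply: eq_card => x; rewrite !inE. Qed.

Lemma degree_induced (x : {x : T | x \in A}) :
  degree (induced G A) x = #|neighbours G (val x) :&: A|.
Proof. by rewrite -card_val_preim; apply: eq_card => y; rewrite !inE. Qed.

End Deletion.

(** * Stability under closure, and the degree condition of Chvatal *)

Section Stability.
Variables (T : finType) (n : nat) (l : int) (P : property).
Hypotheses (cardT : #|T| = n) (hl : (-1 <= l <= n%:Z - 3)%R) (hlP : l = ell P).
Implicit Types (G : graph T) (u v x y : T).

(** The closure ends at a complete graph. The bound [l <= n - 3] leaves three vertices for the cycle
    in every case, after [k] deletions as well as with the apex added. *)
Lemma satisfies_complete G : (forall x y, x != y -> adj G x y) -> satisfies P G.
Proof.
move=> cG; have T2 : 1 < #|T| by lia.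
have ham (U : finType) (H : graph U) : 2 < #|U| ->
    (forall x y : U, x != y -> adj H x y) -> hamiltonian H.
  move=> U3 cH; apply/hamiltonian_through; apply: complete_ham_cycle_through => //.
  exact: linear_forest_empty.
case: P hlP => [|||k|k] /= lP.
- by apply: ham => //; lia.
- apply/traceable_cone => //; apply: ham; first by rewrite card_option; lia.
  by move=> [x|] [y|] //= xy; apply: cG.
- have T3 : 2 < #|T| by lia.
  apply/hamiltonian_connected_through => // x y xy.
  apply: complete_ham_cycle_through => //; last exact: linear_forest_edge.
  by move=> a b ab /=; rewrite cG.
- by move=> F _ lF _; apply: complete_ham_cycle_through => //; lia.
- move=> S Sk; apply: ham.
    by rewrite card_sig_set; have := cardsC S; lia.
  by move=> x y xy; apply: cG; rewrite (inj_eq val_inj).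
Qed.

(** The value of [l] is what the crossing argument costs. The apex raises the order by one and the
    degree sum by two, whence -1; a prescribed edge costs one; deleting [S] lowers the order by
    [#|S|] and the degree sum by at most twice that. *)
Lemma satisfies_add_edge G u v : u != v -> ~~ adj G u v ->
  (n%:Z + l <= (degree G u + degree G v)%:Z)%R ->
  satisfies P (add_edge G u v) -> satisfies P G.
Proof.
move=> uv nuv; case: P hlP => [|||k|k] /= lP deg.
- by apply: hamiltonian_add_edge => //; lia.
- have T2 : 1 < #|T| by lia.
  move=> /(traceable_cone _ T2) h; apply/traceable_cone => //.
  apply: (@hamiltonian_add_edge _ _ (Some u) (Some v)) => //.
    by rewrite card_option !degree_cone; lia.
  by apply: eq_hamiltonian h => -[x|] [y|]; rewrite /= /edge_rel /= ?andbF.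
- have T3 : 2 < #|T| by lia.
  move=> /(hamiltonian_connected_through _ T3) h.
  apply/hamiltonian_connected_through => // x y xy; have := h x y xy.
  (* If the prescribed edge is uv itself, adding it a second time changes nothing. *)
  case: (boolP (edge_rel x y u v)) => [|nxy].
    move/edge_rel_imp => e; apply: eq_ham_cycle_through => a b /=.
    case: e => -[-> ->]; rewrite -orbA; last rewrite (edge_relC y x);
    by rewrite orbb.
  move=> h1; apply: (@ham_cycle_through_add_edge _ _ _ u v 1) => //.
  + by rewrite /= negb_or nuv.
  + by move=> a b /= ->; rewrite orbT.
  + exact: edges_edge_graph.
  + have := degree_sub u (@sub_add_edge _ G x y).
    by have := degree_sub v (@sub_add_edge _ G x y); lia.
  + by apply: eq_ham_cycle_through h1 => a b /=; rewrite orbAC.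
- move=> h F FG lF Fk.
  apply: (@ham_cycle_through_add_edge _ _ _ u v k) => //; first lia.
  by apply: h => // x y /FG; apply: sub_add_edge.
- move=> h S Sk; have := h S Sk.
  (* If an end of uv is deleted, the new edge disappears with it. *)
  case: (boolP (u \in ~: S)) => uS; last first.
    apply: eq_hamiltonian => a b; rewrite /= /induced_adj /=.
    case: (boolP (edge_rel _ _ _ _)); rewrite ?orbF // => /edge_rel_imp.
    by case=> -[e1 e2]; case/negP: uS; rewrite -?e1 -?e2 (valP a, valP b).
  case: (boolP (v \in ~: S)) => vS; last first.
    apply: eq_hamiltonian => a b; rewrite /= /induced_adj /=.
    case: (boolP (edge_rel _ _ _ _)); rewrite ?orbF // => /edge_rel_imp.
    by case=> -[e1 e2]; case/negP: vS; rewrite -?e1 -?e2 (valP a, valP b).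
  move=> h1.
  apply: (@hamiltonian_add_edge _ _ (Sub u uS) (Sub v vS)) => //.
    rewrite !degree_induced card_sig_set !SubK.
    have dS w : degree G w <= #|neighbours G w :&: ~: S| + #|S|.
      rewrite /degree -(cardsID (~: S) (neighbours G w)) leq_add2l subset_leq_card //.
      by apply/subsetP=> z; rewrite !inE negbK => /andP[].
    have := dS u; have := dS v; have := cardsC S; lia.
Qed.

(** Once no edge can be added, take a non-adjacent pair with maximal degree sum and [u] the end of
    smaller degree. Maximality bounds the degrees of the non-neighbours of [v] by that of [u], and
    those of the non-neighbours of [u] by that of [v]; both sets are large since the degree sum is
    below [n + l]. *)
Lemma chvatal_condition G : ~ satisfies P G ->
  exists a i b : nat, [/\ (a%:Z = i%:Z + l)%R, a + i + b = n, 0 < i, 0 < b &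
    i <= #|[set x | degree G x <= a]| /\
    i + b <= #|[set x | degree G x <= a + b - 1]|].
Proof.
(* Induction on the number of non-adjacent ordered pairs: degrees only grow when an edge is added,
   so the bounds found for the larger graph hold for [G]. *)
move: {2}_.+1 (ltnSn #|[set p : T * T | ~~ adj G p.1 p.2]|) => m.
elim: m G => // m IHm G; rewrite ltnS => Gm nP.
pose Q (p : T * T) := (p.1 != p.2) && ~~ adj G p.1 p.2.
case: (boolP [exists p, Q p && (n%:Z + l <= (degree G p.1 + degree G p.2)%:Z)%R]).
  case/existsP=> -[u v] /andP[/andP[/= uv nuv] deg].
  have [|h|a [i [b [e1 e2 e3 e4 [c1 c2]]]]] := IHm (add_edge G u v).
  - apply: leq_trans Gm; apply: proper_card; apply/properP; split.
      by apply/subsetP=> p; rewrite !inE /= negb_or => /andP[].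
    by exists (u, v); rewrite !inE //= edge_relxx ?orbT.
  - by apply: nP; apply: satisfies_add_edge h.
  exists a, i, b; split=> //; split; [apply: leq_trans c1 _ | apply: leq_trans c2 _];
    apply: subset_leq_card; apply/subsetP=> x; rewrite !inE;
    by apply: leq_trans; apply: degree_sub; apply: sub_add_edge.
move/existsPn=> small.
have [p0 Qp0] : exists p, Q p.
  case: (boolP [exists p, Q p]) => [/existsP //|/existsPn none]; case: nP.
  apply: satisfies_complete => x y xy; have := none (x, y).
  by rewrite /Q /= xy negbK.
case: (@arg_maxnP _ p0 Q (fun p => degree G p.1 + degree G p.2) Qp0) => -[u v].
wlog duv : u v / degree G u <= degree G v.
  move=> hw; case/orP: (leq_total (degree G u) (degree G v)) => le; first exact: hw.
  move=> /andP[/= uv nuv] mx; apply: (hw v u) => //=.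
    by rewrite /Q /= eq_sym uv adj_sym.
  by move=> j Qj; have /= := mx j Qj; lia.
move=> Quv mx; have := small (u, v); rewrite Quv /= => deg.
have /andP[/= uv nuv] := Quv.
have cB : #|[set x | (x != v) && ~~ adj G v x]| + (degree G v).+1 = n.
  rewrite /degree -cardT -(cardsC [set x | (x != v) && ~~ adj G v x]); congr (_ + _).
  rewrite (cardsD1 v (~: _)) !inE eqxx /= add1n; congr _.+1; apply: eq_card => x.
  by rewrite !inE negb_and !negbK; case: eqP => //= ->; rewrite adj_irr.
have cM : #|[set x | ~~ adj G u x]| + degree G u = n.
  rewrite /degree -cardT addnC -(cardsC (neighbours G u)); congr (_ + _).
  by apply: eq_card => x; rewrite !inE.
have dB x : x != v -> ~~ adj G v x -> degree G x <= degree G u.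
  move=> xv nvx; have /= := mx (x, v); rewrite leq_add2r; apply.
  by rewrite /Q /= xv adj_sym.
have dM x : ~~ adj G u x -> degree G x <= degree G v.
  move=> nux; case: (eqVneq u x) => [<- //|ux].
  by have /= := mx (u, x); rewrite leq_add2l; apply; rewrite /Q /= ux.
have leB k : degree G u <= k ->
    #|[set x | (x != v) && ~~ adj G v x]| <= #|[set x | degree G x <= k]|.
  move=> uk; apply: subset_leq_card; apply/subsetP=> x; rewrite !inE.
  by case/andP=> xv nvx; apply: leq_trans uk; apply: dB.
have leM k : degree G v <= k ->
    #|[set x | ~~ adj G u x]| <= #|[set x | degree G x <= k]|.
  move=> vk; apply: subset_leq_card; apply/subsetP=> x; rewrite !inE.
  by move=> nux; apply: leq_trans vk; apply: dM.
have B1 : 0 < #|[set x | (x != v) && ~~ adj G v x]|.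
  by apply/card_gt0P; exists u; rewrite inE uv adj_sym.
(* The natural index is the degree of [u] minus [l]. When this is not positive, index 1 works: [u]
   has degree at most [l + 1], and [v], which misses [u], has degree at most [n - 2]. *)
case: (lerP (degree G u)%:Z%R l) => hu.
  exists (absz (1 + l)%R), 1, (absz (n%:Z - l - 2)%R); split; try lia.
  by split; [apply: leq_trans (leB _ _) | apply: leq_trans (leM _ _)]; lia.
exists (degree G u), (absz ((degree G u)%:Z - l)%R),
  (absz (n%:Z - 2 * (degree G u)%:Z + l)%R); split; try lia.
by split; [apply: leq_trans (leB _ _) | apply: leq_trans (leM _ _)]; lia.
Qed.

End Stability.

(** * Three-part graphs and an obstruction to Hamilton cycles *)

Section Layers.
Variable T : finType.
Implicit Types (G F : graph T) (A B : {set T}) (x y : T).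

(** Since [A] and [B] are disjoint, the last clause makes [B] independent as well as separated from
    the rest. *)
Definition three_part G A B : Prop :=
  [/\ [disjoint A & B], (forall x y, x \in A -> x != y -> adj G x y) &
    (forall x y, x \in B -> adj G x y -> y \in A)].

Lemma exists_subset_card A k : k <= #|A| ->
  exists2 S : {set T}, S \subset A & #|S| = k.
Proof.
move=> kA; exists [set x in take k (enum A)].
  by apply/subsetP=> x; rewrite inE => /mem_take; rewrite mem_enum.
rewrite cardsE (card_uniqP _) ?take_uniq ?enum_uniq //.
by rewrite size_takel // -cardE.
Qed.

(* The successor map of the cycle sends [B] into [A]; if the steps inside [A]
   leave no room for more, no vertex outside [A :|: B] precedes [A], and none
   ever precedes [B], so the cycle could not leave the rest. *)
Lemma no_hamilton_cycle G A B c z : [disjoint A & B] ->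
  (forall x y, x \in B -> adj G x y -> y \in A) ->
  0 < #|B| -> z \notin A :|: B ->
  #|A| <= #|B| + #|[set x in A | next c x \in A]| -> ~ hamilton_cycle G c.
Proof.
move=> dAB BA /card_gt0P[b bB] zAB leA [sc cy uc full].
have nextP x : adj G x (next c x) by apply: next_cycle (full x).
set AA := [set x in A | _] in leA.
have eqA : B :|: AA = next c @^-1: A.
  apply/eqP; rewrite eqEcard (card_preimset _ (can_inj (prev_next uc))).
  rewrite cardsU (_ : B :&: AA = set0) ?cards0 ?subn0 ?leA ?andbT.
    apply/subsetP=> x; rewrite !inE => /orP[xB|/andP[_ //]].
    exact: BA xB (nextP x).
  apply/setP=> x; rewrite !inE; apply/negP => /and3P[xB xA _].
  by move/pred0P: dAB => /(_ x) /=; rewrite xA xB.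
have closed x : x \notin A :|: B -> next c x \notin A :|: B.
  move=> xAB; move: (xAB); rewrite !inE => /norP[xA xB]; apply/norP; split.
    by have /setP/(_ x) := eqA; rewrite !inE (negPf xA) (negPf xB) => <-.
  apply/negP => nB; case/negP: xA; apply: BA nB _.
  by rewrite adj_sym.
have [j p ep] := rot_to (full z).
have : fcycle (next c) (z :: p).
  by rewrite -ep rot_cycle; apply: cycle_next.
rewrite /= rcons_path => /andP[pth _].
have stay q x : x \notin A :|: B -> path (frel (next c)) x q ->
    all [pred y | y \notin A :|: B] (x :: q).
  elim: q x => [|y q IHq] x xAB; first by rewrite /= xAB.
  case/andP=> /eqP <- pthq; rewrite [all _ _]/= xAB.
  by apply: IHq pthq; apply: closed.
have := stay p z zAB pth.
move/allP/(_ b); rewrite -ep mem_rot full !inE bB orbT => /(_ isT) //.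
Qed.

(** Prescribed edges inside [A] force the cycle to make that many steps inside [A], which is the
    surplus counted in [no_hamilton_cycle]. *)
Lemma leq_edges_next c F A : cycle_contains c F ->
  (forall x y, adj F x y -> x \in A) ->
  #|edges F| <= #|[set x in A | next c x \in A]|.
Proof.
move=> cF FA; apply: leq_trans (leq_imset_card (fun x => [set x; next c x]) _).
apply: subset_leq_card; apply/subsetP=> e /imsetP[[x y]]; rewrite inE /= => Fxy ->.
have Fyx : adj F y x by rewrite adj_sym.
have xA := FA _ _ Fxy; have yA := FA _ _ Fyx; apply/imsetP.
case/orP: (cF _ _ Fxy) => /eqP e1.
  by exists x; rewrite ?inE -?e1 ?xA.
by exists y; rewrite ?inE -?e1 ?yA // setUC.
Qed.

End Layers.

(** * Three-part graphs do not have the property *)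

Section NotSatisfies.
Variable T : finType.
Implicit Types (G F : graph T) (A B : {set T}) (x y : T).

Definition path_adj (s : seq T) : rel T := [rel x y | (x != y) && consecutive s x y].

Lemma path_adj_sym s : symmetric (path_adj s).
Proof. by move=> x y; rewrite /path_adj /= eq_sym /consecutive orbC. Qed.

Lemma path_adj_irr s : irreflexive (path_adj s).
Proof. by move=> x; rewrite /path_adj /= eqxx. Qed.

Definition path_graph s : graph T := Graph (@path_adj_sym s) (@path_adj_irr s).

Lemma infix2_nth (x0 : T) s i : i.+1 < size s ->
  infix [:: nth x0 s i; nth x0 s i.+1] s.
Proof.
move=> lt; apply/infixP; exists (take i s), (drop i.+2 s).
by rewrite -[LHS](cat_take_drop i) (drop_nth x0 (ltnW lt)) (drop_nth x0 lt).
Qed.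

Lemma infix2_uniq s x y : uniq s -> infix [:: x; y] s -> x != y.
Proof.
by move=> us /infix_uniq /(_ us); rewrite /= inE andbT.
Qed.

Lemma linear_forest_path s : uniq s -> linear_forest (path_graph s).
Proof.
move=> us; exists [:: s]; rewrite /= cats0; split=> // x y; rewrite orbF.
rewrite /path_adj /=; case h : (consecutive s x y); rewrite ?andbF // andbT.
by case/orP: h => /(infix2_uniq us) //; rewrite eq_sym.
Qed.

Lemma card_edges_path s : uniq s -> 0 < size s ->
  #|edges (path_graph s)| = (size s).-1.
Proof.
case: s => // x0 s; set s' := x0 :: s => us _; apply/eqP; rewrite eqn_leq.
apply/andP; split.
  pose f (j : 'I_(size s)) := [set nth x0 s' j; nth x0 s' j.+1].
  rewrite -[X in _ <= X]card_ord -[X in _ <= X]cardsT.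
  apply: leq_trans (leq_imset_card f _); apply: subset_leq_card.
  have sub x y : infix [:: x; y] s' -> [set x; y] \in f @: setT.
    case/infixP=> s1 [s2 es]; have lt : size s1 < size s.
      by have := congr1 size es; rewrite !size_cat /=; lia.
    apply/imsetP; exists (Ordinal lt); rewrite ?inE // /f es /= !nth_cat ltnn.
    rewrite subnn -[_.+1 < _]/(_.+2 <= _) ltnNge leqnSn /= subSnn //=.
  apply/subsetP=> e /imsetP[[x y]]; rewrite inE /= => /andP[_ /orP[]] /sub h ->;
    by rewrite // setUC.
have := @card_path_edges _ (path_graph s') s' x0 (size s) predT us (ltnSn _).
rewrite card_ord; apply=> j _.
have jN := ltn_ord j; have h : infix [:: nth x0 s' j; nth x0 s' j.+1] s'.
  by apply: infix2_nth.
by rewrite /= /path_adj /= (infix2_uniq us h) /consecutive h.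
Qed.

Lemma path_adj_mem s x y : path_adj s x y -> x \in s.
Proof.
by case/andP=> _ /orP[] /mem_infix; apply; rewrite !inE eqxx ?orbT.
Qed.

(** Each case removes the difference [l] between [#|A|] and [#|B|]: the apex joins [A]; one edge, or
    a path with [k] edges, is prescribed inside the clique [A]; or [k] vertices of [A] are deleted.
    Then [no_hamilton_cycle] applies. *)
Lemma three_part_not_satisfies (n : nat) (l : int) (P : property) G A B :
  (-1 <= l <= n%:Z - 3)%R -> l = ell P -> #|T| = n ->
  three_part G A B -> (#|A|%:Z = #|B|%:Z + l)%R ->
  0 < #|B| -> #|A| + #|B| < n -> ~ satisfies P G.
Proof.
move=> hl hlP cardT [dAB AG BA] cA B0 ltn.
have [z zAB] : exists z, z \notin A :|: B.
  apply/existsP; rewrite -negb_forall; apply/negP => /forallP all_in.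
  have : #|A :|: B| = n by rewrite -cardT; apply: eq_card => x; rewrite all_in.
  by have := cardsUI A B; lia.
case: P hlP => [|||k|k] /= lP.
- by case=> c; apply: (no_hamilton_cycle dAB BA B0 zAB); lia.
- have T2 : 1 < #|T| by lia.
  move=> /(traceable_cone _ T2)[c].
  pose A' := None |: [set Some x | x in A]; pose B' := [set Some x | x in B].
  have cA' : #|A'| = #|A|.+1.
    rewrite /A' cardsU1 card_imset; last exact: Some_inj.
    by rewrite (_ : (None \in _) = false) //; apply/negP=> /imsetP[].
  have cB' : #|B'| = #|B| by rewrite card_imset //; apply: Some_inj.
  have memA x : (Some x \in A') = (x \in A).
    by rewrite !inE /= mem_imset //; apply: Some_inj.
  have memB x : (Some x \in B') = (x \in B) by rewrite mem_imset //; apply: Some_inj.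
  have nB : None \notin B' by apply/negP=> /imsetP[].
  apply: (@no_hamilton_cycle _ _ A' B' c (Some z)).
  + apply/pred0P=> -[x|] /=; last by rewrite (negPf nB) andbF.
    by have := pred0P dAB x; rewrite /= memA memB.
  + move=> [x|] y; rewrite ?memB ?(negPf nB) // => xB.
    by case: y => [y|] xy; [rewrite memA; apply: BA xB xy | rewrite !inE].
  + by rewrite cB'.
  + by rewrite in_setU memA memB -in_setU.
  + by rewrite cA' cB'; lia.
- have T3 : 2 < #|T| by lia.
  have /card_gt1P[x [y [xA yA xy]]] : 1 < #|A| by lia.
  move=> /(hamiltonian_connected_through _ T3) /(_ x y xy)[c hc cF].
  (* Both ends lie in the clique [A], so the added edge was already in [G]. *)
  have hc' : hamilton_cycle G c.
    apply: sub_hamilton_cycle hc => a b /orP[//|/edge_rel_imp].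
    by case=> -[-> ->]; apply: AG => //; rewrite eq_sym.
  apply: (no_hamilton_cycle dAB BA B0 zAB) hc'.
  have : #|edges (edge_graph x y)| <= #|[set x in A | next c x \in A]|.
    by apply: leq_edges_next => // a b /edge_rel_imp[] [-> _].
  have : 0 < #|edges (edge_graph x y)|.
    by apply/card_gt0P; exists [set x; y]; apply/imsetP; exists (x, y);
      rewrite ?inE //= edge_relxx.
  lia.
(* A path on [k + 1] vertices of [A] has [k] edges; there are enough vertices because [B] is
   nonempty. *)
- move=> h; pose s := take k.+1 (enum A).
  have us : uniq s by rewrite take_uniq ?enum_uniq.
  have ss : size s = k.+1 by rewrite size_takel // -cardE; lia.
  have sA x : x \in s -> x \in A by move/mem_take; rewrite mem_enum.
  have ek : #|edges (path_graph s)| = k by rewrite card_edges_path // ss.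
  have sub : subgraph (path_graph s) G.
    move=> x y /= xy; apply: AG; first exact: sA (path_adj_mem xy).
    by case/andP: xy.
  have [|c hc cF] := h _ sub (linear_forest_path us); first by rewrite ek.
  apply: (no_hamilton_cycle dAB BA B0 zAB) hc.
  have : #|edges (path_graph s)| <= #|[set x in A | next c x \in A]|.
    by apply: leq_edges_next => // x y /path_adj_mem /sA.
  by rewrite ek; lia.
- have [S SA cS] : exists2 S : {set T}, S \subset A & #|S| = k.
    by apply: exists_subset_card; lia.
  move=> /(_ S); rewrite cS => /(_ (leqnn k))[c].
  have zS : z \in ~: S.
    by rewrite inE; apply: contra zAB => /(subsetP SA); rewrite inE => ->.
  pose pre (D : {set T}) := [set x : {x : T | x \in ~: S} | val x \in D].
  have cpre D : #|pre D| = #|D :&: ~: S| by apply: card_val_preim.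
  have cB : #|B :&: ~: S| = #|B|.
    congr #|pred_of_set _|; apply/setIidPl; rewrite -disjoints_subset.
    by apply: disjointWr SA _; rewrite disjoint_sym.
  have cAS : #|A :&: ~: S| + k = #|A|.
    by rewrite -cS -(cardsID S A) (setIidPr SA) addnC setDE.
  apply: (@no_hamilton_cycle _ _ (pre A) (pre B) c (Sub z zS)).
  + apply/pred0P=> x; rewrite /= !inE.
    exact: (pred0P dAB (val x)).
  + by move=> x y; rewrite !inE; apply: BA.
  + by rewrite cpre cB.
  + by move: zAB; rewrite !inE.
  + by rewrite !cpre cB; lia.
Qed.

End NotSatisfies.

(** * Counting stars by degrees, and the equality case *)

Section StarCount.
Variable T : finType.
Implicit Types (G : graph T) (A B : {set T}) (x y : T).

Lemma handshake G : 2 * #|edges G| = \sum_x degree G x.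
Proof.
pose S := [set p : T * T | adj G p.1 p.2].
pose h (p : T * T) := [set p.1; p.2].
have -> : edges G = h @: S.
  by apply/setP=> e; apply/imsetP/imsetP=> -[p]; rewrite ?inE => gp ->;
    exists p; rewrite ?inE.
have -> : \sum_x degree G x = \sum_(p in S) 1.
  under eq_bigr do rewrite /degree -sum1_card.
  by rewrite pair_big_dep; apply: eq_bigl => p; rewrite !inE.
rewrite (partition_big_imset h) /= mulnC -sum_nat_const.
apply: eq_bigr => e /imsetP[[x y]]; rewrite inE /= => xy ->.
have nxy := adj_neq xy.
rewrite sum1dep_card.
have <- : #|[set (x, y); (y, x)]| = 2 by rewrite cards2 xpair_eqE (negPf nxy).
apply: eq_card => -[u v]; rewrite !inE /h /= !xpair_eqE.
apply/idP/andP=> [/orP[] /andP[/eqP -> /eqP ->]|[uv /eqP euv]].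
- by [].
- by rewrite adj_sym setUC.
have := set21 u v; have := set22 u v; rewrite euv !inE => hv hu.
have nuv := adj_neq uv.
case/orP: hu hv nuv => /eqP -> /orP[] /eqP ->; rewrite ?eqxx ?orbT //.
Qed.

(* For [t = 1] every edge is counted from both ends. *)
Definition centres t := if t == 1 then 2 else 1.

Lemma num_stars_degrees G t : 0 < t ->
  centres t * num_stars G t = \sum_x 'C(degree G x, t).
Proof.
case: t => [//|[|t]] _; last by rewrite mul1n num_starsE.
by rewrite num_stars1 handshake; apply: eq_bigr => x _; rewrite bin1.
Qed.

(** The sum of the binomials of the degrees in a join of a clique of size [a] with [i] isolated
    vertices and a clique of size [b]; for [t = 1] it is twice the number of stars. *)
Definition profile t a i b :=
  i * 'C(a, t) + b * 'C(a + b - 1, t) + a * 'C(a + i + b - 1, t).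

Lemma ltn_bin m m' t : 0 < t <= m' -> m < m' -> 'C(m, t) < 'C(m', t).
Proof.
case: m' => [|m'] /andP[t0 tm] // lt; case: t t0 tm => // t _ tm.
rewrite binS; apply: leq_ltn_trans (leq_bin2l _ (lt : m <= m')) _.
by rewrite -[X in X < _]addn0 ltn_add2l bin_gt0.
Qed.

(** Equal binomials determine the degree as long as the larger one is nonzero; beyond that threshold
    on [t] degrees become invisible. *)
Lemma bin_eq_top m m' t : 0 < t <= m' -> m <= m' -> 'C(m, t) = 'C(m', t) ->
  m = m'.
Proof.
move=> ht; rewrite leq_eqVlt => /predU1P[//|/(ltn_bin ht) lt] e.
by rewrite e ltnn in lt.
Qed.

Lemma degree_full G x : (forall y, x != y -> adj G x y) -> degree G x = #|T|.-1.
Proof.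
move=> h; rewrite -(cardsC1 x); apply: eq_card => y; rewrite !inE.
by case: (eqVneq y x) => [->|n]; rewrite ?adj_irr // h // eq_sym.
Qed.

Lemma degree_full_inv G x y : degree G x = #|T|.-1 -> x != y -> adj G x y.
Proof.
rewrite -(cardsC1 x) => e xy.
have /eqP eN : neighbours G x == [set~ x].
  rewrite eqEcard -/(degree G x) e leqnn andbT; apply/subsetP=> z; rewrite !inE.
  by apply: contraTneq => ->; rewrite adj_irr.
by have /setP/(_ y) := eN; rewrite !inE eq_sym xy.
Qed.

Definition full_rest G A B :=
  forall x y, x \notin A :|: B -> y \notin A :|: B -> x != y -> adj G x y.

(* [A], [B] and the remaining vertices play the roles of the parts of sizes
   [i + l], [i] and [n - 2i - l] of [Gnl n l i]. *)
Definition layers (full : bool) a i b G := exists A B,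
  [/\ three_part G A B, #|A| = a, #|B| = i, #|T| = a + i + b &
    full -> full_rest G A B].

Lemma degree_bottom G A B x : three_part G A B -> x \in B -> degree G x = #|A|.
Proof.
case=> dAB AG BA xB; apply: eq_card => y; rewrite !inE.
apply/idP/idP => [|yA]; first exact: BA xB.
rewrite adj_sym AG //; apply: contraTneq yA => ->.
by apply/negP=> xA; have := pred0P dAB x; rewrite /= xA xB.
Qed.

Lemma degree_rest_subset G A B x : three_part G A B -> x \notin A :|: B ->
  neighbours G x \subset ~: (x |: B).
Proof.
case=> dAB AG BA; rewrite inE => /norP[xA xB].
apply/subsetP=> y; rewrite !inE => xy; apply/norP; split.
  by apply: contraTneq xy => ->; rewrite adj_irr.
by apply: contra xA => yB; apply: BA yB _; rewrite adj_sym.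
Qed.

Lemma card_rest_neighbours B x a i b : x \notin B -> #|B| = i ->
  #|T| = a + i + b -> #|~: (x |: B)| = a + b - 1.
Proof.
by move=> xB cB cT; have := cardsC (x |: B); rewrite cardsU1 xB cB cT; lia.
Qed.

Lemma sum_parts (f : T -> nat) A B : [disjoint A & B] ->
  \sum_x f x = \sum_(x in B) f x + \sum_(x in ~: (A :|: B)) f x +
    \sum_(x in A) f x.
Proof.
move=> dAB; rewrite (bigID [in A]) /= addnC; congr (_ + _).
rewrite (bigID [in B]) /=; congr (_ + _); apply: eq_bigl => x.
  rewrite andbC; case: (boolP (x \in B)) => //= xB.
  by apply/negP => xA; have := pred0P dAB x; rewrite /= xA xB.
by rewrite !inE negb_or.
Qed.

Lemma card_rest A B a i b : [disjoint A & B] -> #|A| = a -> #|B| = i ->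
  #|T| = a + i + b -> #|~: (A :|: B)| = b.
Proof.
move=> dAB cA cB cT; have := cardsC (A :|: B); rewrite cardsU cT cA cB.
by rewrite (disjoint_setI0 dAB) cards0; lia.
Qed.

(** Vertices of the rest have degree at most [a + b - 1]. If [t] exceeds this they contribute
    nothing, so their mutual edges do not matter. *)
Lemma sum_layers full a i b G t : 0 < b -> full || (a + b - 1 < t) ->
  layers full a i b G -> \sum_x 'C(degree G x, t) = profile t a i b.
Proof.
move=> b0 ft [A [B [pAB cA cB cT fr]]]; have [dAB AG BA] := pAB.
rewrite (sum_parts _ dAB) /profile; congr (_ + _ + _).
- rewrite -cB -sum_nat_const; apply: eq_bigr => x xB.
  by rewrite (degree_bottom pAB xB) cA.
- rewrite -{1}(card_rest dAB cA cB cT) -sum_nat_const; apply: eq_bigr => x.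
  rewrite inE => xAB; have xB : x \notin B by apply: contra xAB; rewrite inE orbC => ->.
  have sub := degree_rest_subset pAB xAB.
  have cx := card_rest_neighbours xB cB cT.
  case: (boolP full) ft => [/fr fG _|_ /= lt]; last first.
    rewrite !bin_small // /degree; apply: leq_ltn_trans (subset_leq_card sub) _.
    by rewrite cx.
  congr 'C(_, t); rewrite -cx; apply: eq_card; apply/setP; apply/eqP.
  rewrite eqEsubset sub; apply/subsetP=> y; rewrite !inE => /norP[yx yB].
  case: (boolP (y \in A)) => yA; first by rewrite adj_sym AG.
  by apply: fG; rewrite // ?inE ?negb_or ?yA ?yB // eq_sym.
rewrite -{1}cA -sum_nat_const; apply: eq_bigr => x xA.
by rewrite (degree_full (AG x ^~ xA)) cT; congr 'C(_, t); lia.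
Qed.

Lemma leq_sum_eq (D : {set T}) (f g : T -> nat) :
  (forall x, x \in D -> f x <= g x) ->
  \sum_(x in D) f x <= \sum_(x in D) g x /\
  (\sum_(x in D) g x <= \sum_(x in D) f x -> forall x, x \in D -> f x = g x).
Proof.
move=> le; split=> [|ge x xD]; first exact: leq_sum.
apply/eqP; rewrite eqn_leq le //=; rewrite leqNgt; apply/negP => lt.
have : \sum_(x in D) f x < \sum_(x in D) g x.
  rewrite (bigD1 x xD) [X in _ < X](bigD1 x xD) /= -addSn leq_add //.
  by apply: leq_sum => y /andP[yD _]; apply: le.
by rewrite ltnNge ge.
Qed.

(** Choose [B] among the vertices of degree at most [a], then [C] among the others of degree at most
    [a + b - 1], and compare term by term. Equality makes every vertex of the complement [A]
    adjacent to all others, because [t <= #|T| - 1], and fixes the degrees in [C] when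
    [t <= a + b - 1]. *)
Lemma sum_leq_profile a i b G t : 0 < t <= #|T| - 1 -> #|T| = a + i + b ->
  0 < b ->
  i <= #|[set x | degree G x <= a]| ->
  i + b <= #|[set x | degree G x <= a + b - 1]| ->
  \sum_x 'C(degree G x, t) <= profile t a i b /\
  (\sum_x 'C(degree G x, t) = profile t a i b -> layers (t <= a + b - 1) a i b G).
Proof.
move=> /andP[t0 tn] cT b0 ci cib.
have [B Bsub cB] := exists_subset_card ci.
have [C Csub cC] : exists2 C : {set T},
    C \subset [set x | degree G x <= a + b - 1] :\: B & #|C| = b.
  apply: exists_subset_card.
  rewrite cardsD (setIidPr _) ?cB; first lia.
  by apply/subsetP=> x /(subsetP Bsub); rewrite !inE; lia.
pose A := ~: (B :|: C).
have dAB : [disjoint A & B] by rewrite disjoints_subset setCS subsetUl.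
have dBC : [disjoint B & C].
  by rewrite disjoint_sym disjoints_subset; apply: subset_trans Csub _;
    rewrite setDE subsetIr.
have cA : #|A| = a.
  have := cardsC (B :|: C); rewrite -/A cardsU (disjoint_setI0 dBC) cards0; lia.
have eC : ~: (A :|: B) = C.
  apply/setP=> x; rewrite !inE; case xB : (x \in B) => /=; last by rewrite orbF negbK.
  by apply/esym/negP => xC; have := pred0P dBC x; rewrite /= xB xC.
have degT x : degree G x <= #|T|.-1.
  rewrite -(cardsC1 x) subset_leq_card //; apply/subsetP=> y; rewrite !inE.
  by apply: contraTneq => ->; rewrite adj_irr.
have eT : #|T|.-1 = a + i + b - 1 by lia.
have leC x : x \in C -> degree G x <= a + b - 1.
  by move/(subsetP Csub); rewrite !inE => /andP[].
have leB x : x \in B -> degree G x <= a.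
  by move/(subsetP Bsub); rewrite inE.
have [sB eB] := @leq_sum_eq B (fun x => 'C(degree G x, t)) (fun=> 'C(a, t))
  (fun x xB => leq_bin2l t (leB x xB)).
have [sC eqC] := @leq_sum_eq C (fun x => 'C(degree G x, t))
  (fun=> 'C(a + b - 1, t)) (fun x xC => leq_bin2l t (leC x xC)).
have [sA eA] := @leq_sum_eq A (fun x => 'C(degree G x, t))
  (fun=> 'C(#|T|.-1, t)) (fun x _ => leq_bin2l t (degT x)).
rewrite !sum_nat_const in sB eB sC eqC sA eA.
rewrite cB in sB eB; rewrite cC in sC eqC; rewrite cA eT in sA eA.
rewrite (sum_parts _ dAB) eC /profile; split; first by rewrite !leq_add.
move=> esum.
have pAB : three_part G A B.
  have AG x y : x \in A -> x != y -> adj G x y.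
    move=> xA; apply: degree_full_inv; apply: (@bin_eq_top _ _ t) => //.
      by rewrite t0 -subn1.
    by rewrite eT; apply: eA => //; lia.
  split=> // x y xB xy.
  (* The binomial of [a] may vanish, so equality of the sums says nothing here; instead, [x] is
     adjacent to all of [A] and has degree at most [#|A|]. *)
  suff -> : A = neighbours G x by rewrite inE.
  apply/eqP; rewrite eqEcard cA leB // andbT; apply/subsetP=> z zA.
  rewrite inE adj_sym AG //; apply: contraTneq zA => ->.
  by apply/negP => xA; have := pred0P dAB x; rewrite /= xA xB.
exists A, B; split=> // tab x y xAB yAB xy.
have xC : x \in C by rewrite -eC inE.
have xB : x \notin B by apply: contra xAB => h; rewrite inE h orbT.
have yB : y \notin B by apply: contra yAB => h; rewrite inE h orbT.
have dx : degree G x = a + b - 1.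
  apply: (@bin_eq_top _ _ t); rewrite ?t0 ?leC //.
  by apply: eqC => //; lia.
have /setP/(_ y) : neighbours G x = ~: (x |: B).
  apply/eqP; rewrite eqEcard (degree_rest_subset pAB xAB) /=.
  by rewrite (card_rest_neighbours xB cB cT) -dx.
by rewrite !inE (negPf yB) orbF eq_sym xy => ->.
Qed.

End StarCount.

(** * Convexity in the index *)

(** Raising the index by one adds 1 to [a] and to [i] and takes 2 from [b]. By Pascal's rule the two
    outer values exceed twice the middle one by (i+2)r + 2q + (b+4)g + 4e, where q = C(a,t-1), e =
    C(a+b+1,t-1), and r, g are their increments. *)
Lemma profile_step t a i b : 0 < t <= a + i + b + 3 ->
  profile t a.+1 i.+1 b.+2 < maxn (profile t a i b.+4) (profile t a.+2 i.+2 b).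
Proof.
case: t => // s /= st; rewrite /profile.
have -> : a + b.+4 - 1 = (a + b).+3 by lia.
have -> : a.+1 + b.+2 - 1 = (a + b).+2 by lia.
have -> : a.+2 + b - 1 = (a + b).+1 by lia.
have -> : a + i + b.+4 - 1 = a + i + b + 3 by lia.
have -> : a.+1 + i.+1 + b.+2 - 1 = a + i + b + 3 by lia.
have -> : a.+2 + i.+2 + b - 1 = a + i + b + 3 by lia.
have X0 : 0 < 'C(a + i + b + 3, s.+1) by rewrite bin_gt0.
have aq : 'C(a, s) <= 'C(a.+1, s) by apply: leq_bin2l.
have eg : 'C((a + b).+1, s) <= 'C((a + b).+2, s) by apply: leq_bin2l.
(* The excess is positive when e + g > 0. Otherwise only the vertices of full degree are centres of
   stars, and their number grows with the index. *)
rewrite leq_max; case: (leqP s (a + b).+2) => hs; last first.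
  have z m : m <= (a + b).+3 -> 'C(m, s.+1) = 0 by move=> hm; rewrite bin_small //; lia.
  apply/orP; right; move: X0; set X := 'C(a + i + b + 3, _) => X0.
  by rewrite !z; try lia; rewrite !muln0 !add0n ltn_pmul2r.
have g0 : 0 < 'C((a + b).+2, s) by rewrite bin_gt0.
rewrite !(binS a.+1) !(binS a) !(binS (a + b).+2) !(binS (a + b).+1).
rewrite -(subnKC aq) -(subnKC eg) in g0 *.
move: g0 X0; move: ('C(a.+1, s) - 'C(a, s)) ('C((a + b).+2, s) - _) => r g.
move: 'C(a, s) 'C((a + b).+1, s) 'C(a, s.+1) 'C((a + b).+1, s.+1) => q e p c.
move: 'C(_, _) => X g0 X0.
rewrite !ltnNge -negb_and; apply/negP=> /andP[h1 h2].
have := leq_add h1 h2; move: g0; clear; rewrite !mulSn !mulnDr; lia.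
Qed.

(** A maximiser strictly inside the interval would be smaller than one of its neighbours. *)
Lemma max_at_ends (f : nat -> nat) p q :
  (forall i, p < i < q -> f i < maxn (f i.-1) (f i.+1)) ->
  forall i, p <= i <= q -> [\/ i = p, i = q | f i < maxn (f p) (f q)].
Proof.
move=> convex.
have ends i : p <= i <= q -> f i <= maxn (f p) (f q).
  move=> hi; have pq : p <= q by lia.
  have [j hj maxj] := @arg_maxnP _ (inord p : 'I_q.+1) (fun j => p <= j)
    (fun j => f j) (etrans (congr1 (leq p) (inordK (pq : p < q.+1))) (leqnn p)).
  have jq := ltn_ord j.
  have iq : i < q.+1 by lia.
  have := maxj (Ordinal iq) (andP hi).1; rewrite /= => fij.
  case: (eqVneq (j : nat) p) => [<-|jp]; first by rewrite leq_max fij.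
  case: (eqVneq (j : nat) q) => [<-|nq]; first by rewrite leq_max fij orbT.
  have := convex j; rewrite !ltn_neqAle eq_sym jp hj nq -ltnS jq => /(_ isT).
  rewrite -ltn_neqAle ltnNge geq_max => /negP[]; apply/andP; split.
    have lt : j.-1 < q.+1 by lia.
    by apply: (maxj (Ordinal lt)) => /=; lia.
  have lt : j.+1 < q.+1 by lia.
  by apply: (maxj (Ordinal lt)) => /=; lia.
move=> i hi; case: (eqVneq i p) => [->|ip]; first by constructor 1.
case: (eqVneq i q) => [->|iq]; first by constructor 2.
constructor 3; apply: leq_trans (convex i _) _; first lia.
by rewrite geq_max !ends; lia.
Qed.

(** * Layered graphs up to isomorphism *)

Section Isomorphism.
Variables (n : nat) (l i : int).
Local Notation a := (absz (i + l)%R).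
Local Notation k := (absz i).
Local Notation b := (absz (n%:Z - 2 * i - l)%R).
Local Notation V := (Gvertex n l i).
Local Notation K := (Gnl n l i).

Lemma card_Gvertex : #|{: V}| = a + k + b.
Proof. by rewrite /Gvertex !card_sum !card_ord addnA. Qed.

Lemma isomorphic_layers (T : finType) (G : graph T) (H : graph V) (full : bool) :
  Gfamily H -> (full -> subgraph K H) -> isomorphic G H -> layers full a k b G.
Proof.
move=> [HK KH] fK [f [[g fg gf] fH]].
have f_inj := can_inj fg; have g_inj := can_inj gf.
pose A := [set g (inl j) | j : 'I_a]; pose B := [set g (inr (inl j)) | j : 'I_k].
have cA : #|A| = a.
  by rewrite card_imset ?card_ord // => x y /g_inj[].
have cB : #|B| = k.
  by rewrite card_imset ?card_ord // => x y /g_inj[].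
have memA x : (x \in A) = if f x is inl _ then true else false.
  apply/imsetP/idP => [[j _ ->]|]; first by rewrite gf.
  by case e : (f x) => [j|] // _; exists j => //; rewrite -e fg.
have memB x : (x \in B) = if f x is inr (inl _) then true else false.
  apply/imsetP/idP => [[j _ ->]|]; first by rewrite gf.
  by case e : (f x) => [|[j|]] // _; exists j => //; rewrite -e fg.
have KHn u v : adj K u v -> ~~ in_last_clique u || ~~ in_last_clique v -> adj H u v.
  move=> Kuv nl; case h : (adj H u v) => //.
  by have [] := KH u v Kuv (negbT h); move: nl; case/orP=> /negPf ->.
exists A, B; split=> //.
- split.
  + apply/pred0P=> x /=; rewrite memA memB; by case: (f x).
  + move=> x y; rewrite memA -fH => xA xy; apply: KHn.
      case ex : (f x) xA => [j|] // _; case ey : (f y) => [j'|] //=.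
      by apply: contraNneq xy => e; rewrite -(inj_eq f_inj) ex ey e.
    by case: (f x) xA.
  + move=> x y; rewrite memB memA -fH => xB /HK.
    by case: (f x) xB => [|[j|]] //; case: (f y) => [|[]].
- by rewrite -card_Gvertex; apply: bij_eq_card (Bijective fg gf).
move=> /fK KH' x y; rewrite !inE memA memB memA memB => xAB yAB xy.
rewrite -fH; apply: KH'; have : f x != f y by rewrite (inj_eq f_inj).
by case: (f x) xAB => [|[]] //= u _; case: (f y) yAB => [|[]].
Qed.

(** Numbering the three parts transports [G] to the vertices of [Gnl n l i]; [three_part] then
    decides every adjacency outside the last clique. *)
Lemma layers_isomorphic (T : finType) (G : graph T) (full : bool) :
  layers full a k b G ->
  exists H : graph V, [/\ Gfamily H, full -> subgraph K H & isomorphic G H].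
Proof.
case=> A [B [pAB cA cB cT fr]]; have [dAB AG BA] := pAB.
have cC := card_rest dAB cA cB cT.
pose g (u : V) : T := match u with
  | inl j => enum_val (cast_ord (esym cA) j)
  | inr (inl j) => enum_val (cast_ord (esym cB) j)
  | inr (inr j) => enum_val (cast_ord (esym cC) j)
  end.
have gA j : g (inl j) \in A by apply: enum_valP.
have gB j : g (inr (inl j)) \in B by apply: enum_valP.
have gC j : g (inr (inr j)) \notin A :|: B.
  by rewrite -in_setC; apply: enum_valP.
have AB x : x \in A -> x \in B -> False.
  by move=> xA xB; have := pred0P dAB x; rewrite /= xA xB.
have g_inj : injective g.
  have inC x : x \notin A :|: B -> (x \in A = false) * (x \in B = false).
    by rewrite inE => /norP[/negPf-> /negPf->].
  move=> [j|[j|j]] [j'|[j'|j']] e;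
    try (by congr (inl _); apply: cast_ord_inj (enum_val_inj e));
    try (by congr (inr (inl _)); apply: cast_ord_inj (enum_val_inj e));
    try (by congr (inr (inr _)); apply: cast_ord_inj (enum_val_inj e)).
  all: try (by have := gA j; have := gC j'; rewrite -e => /inC ->).
  all: try (by have := gB j; have := gC j'; rewrite -e => /inC ->).
  all: try (by have := gA j'; have := gC j; rewrite e => /inC ->).
  all: try (by have := gB j'; have := gC j; rewrite e => /inC ->).
  - by case: (AB _ (gA j)); rewrite e.
  - by case: (AB _ (gA j')); rewrite -e.
have [f gf fg] : bijective g.
  by apply: inj_card_bij g_inj _; rewrite card_Gvertex cT.
pose r : rel V := fun u v => adj G (g u) (g v).
have r_sym : symmetric r by move=> u v; apply: adj_sym.
have r_irr : irreflexive r by move=> u; apply: adj_irr.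
exists (Graph r_sym r_irr).
have top j v : inl j != v -> adj G (g (inl j)) (g v).
  by rewrite -(inj_eq g_inj); apply: AG; apply: gA.
split.
- split=> [u v|u v Kuv].
    move: u v => [j|[j|j]] [j'|[j'|j']] //; rewrite /= /r => gg.
    + by apply: contraTneq (adj_neq gg) => ->; rewrite eqxx.
    + by case: (AB _ (BA _ _ (gB j) gg) (gB j')).
    + by have := gC j'; rewrite inE (BA _ _ (gB j) gg).
    + by rewrite adj_sym in gg; have := gC j; rewrite inE (BA _ _ (gB j') gg).
    + by apply: contraTneq (adj_neq gg) => ->; rewrite eqxx.
  have uv := adj_neq Kuv; rewrite /= /r.
  move: u v Kuv uv => [j|u] [j'|v] Kuv uv.
  + by rewrite top.
  + by rewrite top.
  + by rewrite adj_sym top // eq_sym.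
  + by case: u v Kuv {uv} => [j|j] [j'|j'].
- move=> /fr fG u v Kuv; have uv := adj_neq Kuv; rewrite /= /r.
  move: u v Kuv uv => [j|u] [j'|v] Kuv uv.
  + by rewrite top.
  + by rewrite top.
  + by rewrite adj_sym top // eq_sym.
  + case: u v Kuv uv => [j|j] [j'|j'] // _ uv.
    by apply: fG; rewrite ?gC // (inj_eq g_inj).
- by exists f; split=> [|x y]; [exists g | rewrite /= /r !fg].
Qed.

Lemma Gfamily_Gnl : Gfamily K.
Proof. by split=> // u v ->. Qed.

Lemma isomorphic_GnlP (T : finType) (G : graph T) :
  isomorphic G K <-> layers true a k b G.
Proof.
split=> [|/layers_isomorphic[H [[HK _] /(_ isT) KH [f [bf fH]]]]].
  by move=> iso; exact: (isomorphic_layers Gfamily_Gnl (fun _ _ _ h => h) iso).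
exists f; split=> // x y; rewrite -fH; apply/idP/idP; [exact: KH | exact: HK].
Qed.

Lemma in_GfamilyP (T : finType) (G : graph T) :
  in_Gfamily n l i G <-> layers false a k b G.
Proof.
split=> [[H hH]|/layers_isomorphic[H [hH _ iso]]]; last by exists H.
exact: isomorphic_layers.
Qed.

End Isomorphism.

(** * Extremal graphs and the range of the index *)

Section Extremal.
Variables (n : nat) (l : int) (t d : nat) (P : property).
Hypotheses (hl : (-1 <= l <= n%:Z - 3)%R) (ht : 1 <= t <= n - 1).
Hypotheses (hd : (d%:Z <= ((n%:Z + l - 1) %/ 2)%Z)%R) (hlP : l = ell P).

Definition top_size (i : nat) : nat := absz (i%:Z + l)%R.
Definition rest_size (i : nat) : nat := absz (n%:Z - 2 * i%:Z - l)%R.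

(** The second bound is the one on [i] freed of division; it says that [rest_size i] is positive. *)
Definition admissible_index i := (0 < i) && (2 * i%:Z <= n%:Z - 1 - l)%R.

(** The rest has degrees at most [n - i - 1], so it must be complete exactly when its vertices could
    be centres of [t]-stars. *)
Definition layered (T : finType) (G : graph T) i :=
  layers (t <= n - i - 1) (top_size i) i (rest_size i) G.

Definition star_sum i := profile t (top_size i) i (rest_size i).

Lemma sizes i : admissible_index i ->
  [/\ ((top_size i)%:Z = i%:Z + l)%R, top_size i + i + rest_size i = n,
      0 < rest_size i & top_size i + rest_size i - 1 = n - i - 1].
Proof. by rewrite /admissible_index /top_size /rest_size; split; lia. Qed.

Lemma layered_candidate (T : finType) (G : graph T) i full :
  admissible_index i -> d <= top_size i ->
  layers full (top_size i) i (rest_size i) G -> candidate n d P G.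
Proof.
move=> hi da [A [B [pAB cA cB cT _]]]; have [e1 e2 e3 _] := sizes hi.
have [dAB AG BA] := pAB; have cTn : #|T| = n by rewrite cT.
split=> //; last first.
  by apply: (three_part_not_satisfies hl hlP cTn pAB); case/andP: hi; lia.
apply/leq_min_degree; first by lia.
move=> x; apply: leq_trans da _; case: (boolP (x \in A)) => xA.
  by rewrite (degree_full (AG x ^~ xA)) cT; case/andP: hi; lia.
rewrite -cA; apply: subset_leq_card; apply/subsetP=> y yA; rewrite inE adj_sym.
by apply: AG => //; apply: contraNneq xA => <-.
Qed.

Lemma layered_stars (T : finType) (G : graph T) i : admissible_index i ->
  layered G i -> centres t * num_stars G t = star_sum i.
Proof.
move=> hi; have [e1 e2 e3 e4] := sizes hi.
rewrite num_stars_degrees; last by case/andP: ht.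
by apply: sum_layers => //; rewrite e4 ltnNge orbN.
Qed.

Lemma candidate_stars (T : finType) (G : graph T) : candidate n d P G ->
  exists i, [/\ admissible_index i, d <= top_size i,
    centres t * num_stars G t <= star_sum i &
    centres t * num_stars G t = star_sum i -> layered G i].
Proof.
case=> cT dG nP.
have [a [i [b [e1 e2 i0 b0 [c1 c2]]]]] := chvatal_condition cT hl hlP nP.
have ea : a = top_size i by rewrite /top_size; lia.
have eb : b = rest_size i by rewrite /rest_size; lia.
have hi : admissible_index i by rewrite /admissible_index; lia.
have [_ _ _ e4] := sizes hi.
have ht' : 0 < t <= #|T| - 1 by rewrite cT.
have [le eq] := sum_leq_profile ht' (etrans cT (esym e2)) b0 c1 c2.
exists i; rewrite num_stars_degrees; last by case/andP: ht.
rewrite /star_sum /layered -e4 -ea -eb; split=> //.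
(* Some vertex has degree at most [a], so the minimum degree forces [d <= a]. *)
have /card_gt0P[x] : 0 < #|[set x | degree G x <= a]| by lia.
rewrite inE; apply: leq_trans.
by move: x; apply/leq_min_degree => //; rewrite cT; lia.
Qed.

Lemma star_sum_step i : admissible_index i -> admissible_index i.+2 ->
  star_sum i.+1 < maxn (star_sum i) (star_sum i.+2).
Proof.
rewrite /admissible_index => hi hi2; rewrite /star_sum.
have -> : top_size i.+1 = (top_size i).+1 by rewrite /top_size; lia.
have -> : top_size i.+2 = (top_size i).+2 by rewrite /top_size; lia.
have -> : rest_size i = (rest_size i.+2).+4 by rewrite /rest_size; lia.
have -> : rest_size i.+1 = (rest_size i.+2).+2 by rewrite /rest_size; lia.
by apply: profile_step; rewrite /top_size /rest_size; lia.
Qed.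

Variables p q : nat.
Hypotheses (hp : idx_d l d = p) (hq : idx_0 n l = q).

(** The degree condition [d <= i + l] supplies the lower end of the range, the positivity of the
    rest the upper one. *)
Lemma index_range i :
  (admissible_index i && (d <= top_size i)) = (p <= i <= q).
Proof.
move: hp hq; rewrite /idx_d /idx_0 /admissible_index /top_size.
by move=> ep eq; apply/idP/idP; lia.
Qed.

Lemma leq_p_q : p <= q.
Proof. by move: hp hq; rewrite /idx_d /idx_0; lia. Qed.

Lemma star_sum_ends i : p <= i <= q ->
  [\/ i = p, i = q | star_sum i < maxn (star_sum p) (star_sum q)].
Proof.
apply: max_at_ends => -[|j] hj; first by lia.
have /andP[aj _] : admissible_index j && (d <= top_size j).
  by rewrite index_range; lia.
have /andP[aj2 _] : admissible_index j.+2 && (d <= top_size j.+2).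
  by rewrite index_range; lia.
exact: star_sum_step.
Qed.

Lemma Gnl_layered i : layers true (top_size i) i (rest_size i) (Gnl n l i).
Proof. by apply/(@isomorphic_GnlP n l i); exists id; split=> //; exists id. Qed.

Lemma layersW (T : finType) (G : graph T) full a i b :
  layers true a i b G -> layers full a i b G.
Proof. by case=> A [B [? ? ? ? fr]]; exists A, B; split=> // _; apply: fr. Qed.

Lemma stars_Gnl i : admissible_index i ->
  centres t * num_stars (Gnl n l i) t = star_sum i.
Proof. by move=> hi; apply: layered_stars => //; apply/layersW/Gnl_layered. Qed.

Lemma centres_gt0 : 0 < centres t.
Proof. by rewrite /centres; case: ifP. Qed.

Lemma admissible_p : admissible_index p && (d <= top_size p).
Proof. by rewrite index_range leqnn leq_p_q. Qed.

Lemma admissible_q : admissible_index q && (d <= top_size q).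
Proof. by rewrite index_range leqnn leq_p_q. Qed.

Lemma star_boundE :
  centres t * star_bound n l t d = maxn (star_sum p) (star_sum q).
Proof.
case/andP: admissible_p => ap _; case/andP: admissible_q => aq _.
by rewrite /star_bound hp hq maxnMr !stars_Gnl.
Qed.

Lemma candidate_leq_star_bound (T : finType) (G : graph T) :
  candidate n d P G -> num_stars G t <= star_bound n l t d.
Proof.
move=> /candidate_stars[i [hi da le _]].
rewrite -(leq_pmul2l centres_gt0) star_boundE; apply: leq_trans le _.
have : p <= i <= q by rewrite -index_range hi.
case/star_sum_ends => [->|->|/ltnW //]; by rewrite leq_max leqnn ?orbT.
Qed.

(** Interior indices stay strictly below the bound, so only the ends occur; which end does depends
    on the comparison of the two sums. *)
Lemma extremal_layered (T : finType) (G : graph T) :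
  extremal n l t d P G <->
  (star_sum q <= star_sum p /\ layered G p) \/
  (star_sum p <= star_sum q /\ layered G q).
Proof.
split=> [[cG sG]|].
  have [i [hi da le eq]] := candidate_stars cG.
  have : p <= i <= q by rewrite -index_range hi.
  move: le eq; rewrite sG star_boundE => le eq.
  case/star_sum_ends => [e|e|lt]; last by rewrite leqNgt lt in le.
    left; rewrite -e in le eq *; move: le; rewrite geq_max => /andP[_ le]; split=> //.
    by apply: eq; apply/maxn_idPl.
  right; rewrite -e in le eq *; move: le; rewrite geq_max => /andP[le _]; split=> //.
  by apply: eq; apply/maxn_idPr.
case/andP: admissible_p => ap dp; case/andP: admissible_q => aq dq.
have done i : admissible_index i -> d <= top_size i -> layered G i ->
    star_sum i = maxn (star_sum p) (star_sum q) -> extremal n l t d P G.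
  move=> hi da Gi e; split; first exact: layered_candidate hi da Gi.
  apply/eqP; rewrite -(eqn_pmul2l centres_gt0) star_boundE -e; apply/eqP.
  exact: layered_stars.
by case=> -[le Gi]; [apply: (done p) | apply: (done q)] => //; apply/esym;
  [apply/maxn_idPl | apply/maxn_idPr].
Qed.

Lemma layeredP (T : finType) (G : graph T) i :
  (t <= n - i - 1 -> layered G i <-> isomorphic G (Gnl n l i)) /\
  (n - i - 1 < t -> layered G i <-> in_Gfamily n l i G).
Proof.
rewrite /layered; split=> [->|]; first by apply: iff_sym; apply: isomorphic_GnlP.
by rewrite ltnNge => /negPf->; apply: iff_sym; apply: in_GfamilyP.
Qed.

End Extremal.

Local Open Scope ring_scope.

Theorem theorem7 (n : nat) (l : int) (t d : nat) (P : property)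
    (hl : -1 <= l <= n%:Z - 3)
    (ht : (1 <= t <= n - 1)%N)
    (hd : d%:Z <= ((n%:Z + l - 1) %/ 2)%Z)
    (hP : admissible n P)
    (hlP : l = ell P) :
  let i_d := idx_d l d in
  let i_0 := idx_0 n l in
  let s := fun i : int => num_stars (Gnl n l i) t in
  let ext := fun (T : finType) (G : graph T) => extremal n l t d P G in
  (forall (T : finType) (G : graph T),
     candidate n d P G -> (num_stars G t <= star_bound n l t d)%N) /\
  [/\ (s i_d < s i_0)%N ->
        (t%:Z <= n%:Z - i_0 - 1 ->
           forall (T : finType) (G : graph T),
             ext T G <-> isomorphic G (Gnl n l i_0)) /\
        (t%:Z > n%:Z - i_0 - 1 ->
           forall (T : finType) (G : graph T),
             ext T G <-> in_Gfamily n l i_0 G),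
      (s i_d > s i_0)%N ->
        (t%:Z <= n%:Z - i_d - 1 ->
           forall (T : finType) (G : graph T),
             ext T G <-> isomorphic G (Gnl n l i_d)) /\
        (t%:Z > n%:Z - i_d - 1 ->
           forall (T : finType) (G : graph T),
             ext T G <-> in_Gfamily n l i_d G)
    & s i_d = s i_0 ->
        [/\ t%:Z <= n%:Z - i_0 - 1 ->
              forall (T : finType) (G : graph T),
                ext T G <->
                isomorphic G (Gnl n l i_d) \/ isomorphic G (Gnl n l i_0),
            n%:Z - i_0 - 1 < t%:Z <= n%:Z - i_d - 1 ->
              forall (T : finType) (G : graph T),
                ext T G <->
                in_Gfamily n l i_0 G \/ isomorphic G (Gnl n l i_d)
          & t%:Z > n%:Z - i_d - 1 ->
              forall (T : finType) (G : graph T),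
                ext T G <->
                in_Gfamily n l i_d G \/ in_Gfamily n l i_0 G]].

Proof.
move=> i_d i_0 s ext.
(* Both indices are at least 1, so they can be read as natural numbers. *)
have [p hp] : exists p : nat, i_d = p%:Z.
  by exists (absz i_d); rewrite /i_d /idx_d; lia.
have [q hq] : exists q : nat, i_0 = q%:Z.
  by exists (absz i_0); rewrite /i_0 /idx_0; lia.
have pq := leq_p_q hl ht hd hlP hp hq.
have [/andP[ap _] /andP[aq _]] :=
  (admissible_p hl ht hd hlP hp hq, admissible_q hl ht hd hlP hp hq).
have extP (T : finType) (G : graph T) : ext T G <->
    ((s q <= s p)%N /\ layered n l t G p) \/
    ((s p <= s q)%N /\ layered n l t G q).
  (* The common factor [centres t] turns comparisons of star numbers into comparisons of degree
     sums. *)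
  rewrite -[(s q <= s p)%N](leq_pmul2l (centres_gt0 t)).
  rewrite -[(s p <= s q)%N](leq_pmul2l (centres_gt0 t)) /s.
  rewrite (stars_Gnl hl ht hd hlP ap) (stars_Gnl hl ht hd hlP aq).
  exact: (extremal_layered hl ht hd hlP hp hq G).
split; first by move=> T G; exact: (candidate_leq_star_bound hl ht hd hlP hp hq).
have isoP i : admissible_index n l i -> t%:Z <= n%:Z - i%:Z - 1 ->
    forall (T : finType) (G : graph T),
      layered n l t G i <-> isomorphic G (Gnl n l i).
  move=> /andP[i0 i1] ti T G; apply: (layeredP n l t G i).1; lia.
have famP i : admissible_index n l i -> n%:Z - i%:Z - 1 < t%:Z ->
    forall (T : finType) (G : graph T),
      layered n l t G i <-> in_Gfamily n l i G.
  move=> /andP[i0 i1] ti T G; apply: (layeredP n l t G i).2; lia.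
rewrite hp hq; split=> [lt|lt|eq].
- have ext_q T G : ext T G <-> layered n l t G q.
    rewrite extP (ltnW lt) leqNgt lt; split=> [[[]|[]]|] //; by right.
  by split=> tq T G; rewrite ext_q; [apply: isoP | apply: famP].
- have ext_p T G : ext T G <-> layered n l t G p.
    rewrite extP (ltnW lt) leqNgt lt; split=> [[[]|[]]|] //; by left.
  by split=> tp T G; rewrite ext_p; [apply: isoP | apply: famP].
have ext_pq T G : ext T G <-> layered n l t G p \/ layered n l t G q.
  rewrite extP eq leqnn; split=> [[[_]|[_]]|[]]; by [left|right].
split=> [tq|/andP[tq tp]|tp] T G; rewrite ext_pq.
(* As [p <= q], the threshold on [t] for [q] is the smaller of the two. *)
- by rewrite isoP ?isoP //; lia.
- by rewrite isoP // famP // or_comm.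
- by rewrite !famP //; lia.
Qed.
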